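(* Let $A(4,1,0)$ be the set of positive integers $n$ satisfying $\sigma(4n+1) > \sigma(4n)$. Its natural density $\mathbf{d}A(4,1,0)$ satisfies $$0.0107553 \leq \mathbf{d}A(4,1,0) \leq 0.0207187.$$
   Context: For a positive integer $n$, $\sigma(n) = \sum_{d\mid n} d$ denotes the sum of all positive divisors of $n$. For a set $A$ of positive integers, its natural density is $\mathbf{d}A = \lim_{x\to\infty} \frac{1}{x}\,\#\{n\in A : n\leq x\}$ when this limit exists. For all integers $k>r_1>r_2\geq 0$, the natural density of $A(k,r_1,r_2)=\{n\geq 1 : \sigma(kn+r_1)>\sigma(kn+r_2)\}$ exists (a separate result of the paper), so $\mathbf{d}A(4,1,0)$ is well defined. *)

(* Defs.v *)
From Stdlib Require Import Reals.
From Coquelicot Require Import Coquelicot.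
From mathcomp Require Import all_boot.

Set Implicit Arguments.
Unset Strict Implicit.
Unset Printing Implicit Defensive.

Local Open Scope nat_scope.

Definition sum_divisors (n : nat) : nat := \sum_(d <- divisors n) d.

Definition setA (k r1 r2 : nat) : pred nat :=
  [pred n | (0 < n) && (sum_divisors (k * n + r1) > sum_divisors (k * n + r2))].

Definition counting (A : pred nat) (x : nat) : nat := count A (iota 1 x).

(* [Lim_seq] is total: it is the limit whenever the limit exists, and the
   midpoint of the lower and upper limits otherwise. *)
Definition natural_density (A : pred nat) : Rbar :=
  Lim_seq (fun x : nat => Rdiv (INR (counting A x)) (INR x)).

(* Main.v *)
(* Write h(n) = sigma(n)/n.  Up to a negligible factor, n lies in A(4,1,0) exactly
   when h(4n+1) > h(4n).  The primes above a large Q change h by more than a factor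
   1 + slack only on a set of density O(1/Q) (Markov), and the contributions of the
   primes p <= Q to h(4n+1)/h(4n) are, by the Chinese remainder theorem, independent
   over a period, as soon as the valuations are capped.  The probability that such a
   product of independent factors is at least 1/t is bounded by branching over the
   primes 2, 3, 5, 7, ... in turn, and by stopping as soon as Chernoff's bound
   t^k E[prod^k], k = 2, 4, ..., 256, is sharp enough; for the primes above 199 the
   moments are bounded uniformly in Q, since a factor has k-th moment 1 + O(k^2/p^3).
   The search is evaluated in fixed-point arithmetic; the roles of 4n and 4n+1 are
   exchanged to bound the complement. *)
Require Import Defs.
From Stdlib Require Import Reals NArith Lra.
From Coquelicot Require Import Coquelicot.
From HB Require Import structures.
From mathcomp Require Import all_boot all_order all_algebra.
From mathcomp Require Import zify ring lra.

Set Implicit Arguments.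
Unset Strict Implicit.
Unset Printing Implicit Defensive.

Import Order.TTheory GRing.Theory Num.Theory.

Local Open Scope ring_scope.

(** * Abundancy *)

Definition abund (n : nat) : rat := (sum_divisors n)%:R / n%:R.

Lemma big_divisors (n N : nat) (F : nat -> rat) : (0 < n < N)%N ->
  \sum_(d <- divisors n) F d = \sum_(1 <= d < N | (d %| n)%N) F d.
Proof.
case/andP=> n_gt0 ltnN; rewrite -[RHS]big_filter; apply/perm_big/uniq_perm.
- exact: divisors_uniq.
- by rewrite filter_uniq ?iota_uniq.
move=> d; rewrite mem_filter mem_index_iota -dvdn_divisors //.
case: (boolP (d %| n)%N) => //= dvd_dn.
by rewrite (dvdn_gt0 n_gt0 dvd_dn) (leq_ltn_trans (dvdn_leq n_gt0 dvd_dn) ltnN).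
Qed.

(** The involution d -> n / d permutes the divisors and turns d / n into the reciprocal of a
    divisor. *)
Lemma abund_sum (n : nat) : (0 < n)%N ->
  abund n = \sum_(d <- divisors n) d%:R^-1.
Proof.
move=> n_gt0; have n_neq0 : n%:R != 0 :> rat by rewrite pnatr_eq0 -lt0n.
rewrite /abund /sum_divisors natr_sum mulr_suml.
have: perm_eq (divisors n) [seq (n %/ d)%N | d <- divisors n].
  apply: uniq_perm; first exact: divisors_uniq.
  - rewrite map_inj_in_uniq ?divisors_uniq // => d e.
    rewrite -!dvdn_divisors // => dvd_d dvd_e eq_de.
    apply/eqP; rewrite -(eqn_pmul2l (m := n %/ d)) ?divn_gt0 ?(dvdn_gt0 n_gt0) //.
    + by rewrite divnK // eq_de divnK.
    exact: dvdn_leq.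
  - move=> d; rewrite -dvdn_divisors //; apply/idP/mapP => [dvd_d | [e]].
      exists (n %/ d)%N; last by rewrite divnA // mulKn.
      by rewrite -dvdn_divisors // dvdn_div.
    by rewrite -dvdn_divisors // => dvd_e ->; rewrite dvdn_div.
move=> perm_div; rewrite {1}(perm_big _ perm_div) /= big_map big_seq [RHS]big_seq.
apply: eq_bigr => d; rewrite -dvdn_divisors // => dvd_d.
have d_gt0 := dvdn_gt0 n_gt0 dvd_d.
have d_neq0 : d%:R != 0 :> rat by rewrite pnatr_eq0 -lt0n.
have -> : n%:R = (n %/ d)%:R * d%:R :> rat by rewrite -natrM divnK.
have nd_neq0 : (n %/ d)%:R != 0 :> rat.
  by rewrite pnatr_eq0 -lt0n divn_gt0 // dvdn_leq.
by rewrite invfM mulrA mulfV // mul1r.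
Qed.

Lemma abund_gt0 n : (0 < n)%N -> 0 < abund n.
Proof.
move=> n_gt0; rewrite divr_gt0 ?ltr0n //.
by rewrite /sum_divisors (big_rem 1%N) ?divisor1 //= addn_gt0.
Qed.

Lemma abund_dvd d n : (0 < n)%N -> (d %| n)%N -> abund d <= abund n.
Proof.
move=> n_gt0 dvd_dn; have d_gt0 := dvdn_gt0 n_gt0 dvd_dn.
rewrite !abund_sum // (@big_divisors d n.+1) ?(@big_divisors n n.+1) ?n_gt0 ?ltnSn //.
  rewrite big_mkcond [leRHS]big_mkcond; apply: ler_sum => e _.
  case: ifP => [/dvdn_trans -> // | _]; case: ifP => // _.
  by rewrite invr_ge0.
by rewrite d_gt0 ltnS dvdn_leq.
Qed.

Lemma abund1 : abund 1 = 1.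
Proof. by rewrite abund_sum // big_seq1 invr1. Qed.

(** A divisor of m * n is d * e with d | m and e | n in exactly one way: d and e are recovered as
    its gcds with m and with n. *)
Lemma abundM m n : (0 < m)%N -> (0 < n)%N -> coprime m n ->
  abund (m * n) = abund m * abund n.
Proof.
move=> m_gt0 n_gt0 co_mn; rewrite !abund_sum ?muln_gt0 ?m_gt0 //.
have gcdl d e : (d %| m)%N -> (e %| n)%N -> gcdn (d * e) m = d.
  move=> dvd_d dvd_e; rewrite gcdnC Gauss_gcdl; first exact/gcdn_idPr.
  exact: coprime_dvdr co_mn.
have gcdr d e : (d %| m)%N -> (e %| n)%N -> gcdn (d * e) n = e.
  move=> dvd_d dvd_e; rewrite gcdnC Gauss_gcdr; first exact/gcdn_idPr.
  by rewrite coprime_sym; apply: coprime_dvdl co_mn.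
have: perm_eq (divisors (m * n)) [seq (d * e)%N | d <- divisors m, e <- divisors n].
  apply: uniq_perm; first exact: divisors_uniq.
    apply: allpairs_uniq; try exact: divisors_uniq.
    move=> [d e] [d' e'] /allpairsP[[x y] /= [xm yn [-> ->]]].
    move=> /allpairsP[[x' y'] /= [xm' yn' [-> ->]]] eq_xy.
    move: xm yn xm' yn'; rewrite -!dvdn_divisors // => xm yn xm' yn'.
    by rewrite -(gcdl x y) // eq_xy gcdl // -{1}(gcdr x y) // eq_xy gcdr.
  move=> d; rewrite -dvdn_divisors ?muln_gt0 ?m_gt0 //.
  apply/idP/allpairsP => [dvd_d | [[x y] /= [xm yn ->]]].
    exists (gcdn d m, gcdn d n); rewrite -!dvdn_divisors // !dvdn_gcdr; split => //=.
    apply/eqP; rewrite eqn_dvd; apply/andP; split.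
      by rewrite muln_gcdl dvdn_gcd dvdn_mulr // muln_gcdr dvdn_gcd dvdn_mull.
    rewrite Gauss_dvd ?dvdn_gcdl //.
    by apply: coprime_dvdl (dvdn_gcdr _ _) _; apply: coprime_dvdr (dvdn_gcdr _ _) _.
  by rewrite dvdn_mul // dvdn_divisors.
move=> perm_div; rewrite (perm_big _ perm_div) /= big_allpairs_dep /= big_distrlr /=.
by apply: eq_bigr => d _; apply: eq_bigr => e _; rewrite natrM invfM.
Qed.

Lemma abund_pfactor p v : prime p ->
  abund (p ^ v) * (p%:R - 1) = p%:R - (p ^ v)%:R^-1.
Proof.
move=> p_pr; have p0 : p%:R != 0 :> rat by rewrite pnatr_eq0 -lt0n prime_gt0.
elim: v => [|v IHv]; first by rewrite expn0 abund1 invr1 mul1r.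
have -> : abund (p ^ v.+1) = abund (p ^ v) + (p ^ v.+1)%:R^-1.
  rewrite !abund_sum ?expn_gt0 ?prime_gt0 //.
  have div_p w : perm_eq (divisors (p ^ w)) [seq (p ^ i)%N | i <- iota 0 w.+1].
    apply: uniq_perm; first exact: divisors_uniq.
      rewrite map_inj_uniq ?iota_uniq // => i j /eqP.
      by rewrite eqn_exp2l ?prime_gt1 // => /eqP.
    move=> d; rewrite -dvdn_divisors ?expn_gt0 ?prime_gt0 //.
    apply/(dvdn_pfactor _ _ p_pr)/mapP => [[i lei ->] | [i]].
      by exists i; rewrite // mem_iota.
    by rewrite mem_iota add0n ltnS => lei ->; exists i.
  rewrite (perm_big _ (div_p v)) (perm_big _ (div_p v.+1)) -[v.+2]addn1 iotaD.
  by rewrite map_cat big_cat big_seq1.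
rewrite mulrDl IHv expnS natrM invfM.
have: (p ^ v)%:R != 0 :> rat by rewrite pnatr_eq0 -lt0n expn_gt0 prime_gt0.
by move: (p ^ v)%:R => q q0; field; rewrite p0 q0.
Qed.

(* For g = gcd(m, q) with q a power of p, abund of the p-part of m, times p - 1, is at
   most upper_fac p q g and at least lower_fac p g; the factors p - 1 cancel in ratios. *)
Definition upper_fac (p q g : nat) : rat :=
  if g == q then p%:R else p%:R - g%:R^-1.

Definition lower_fac (p g : nat) : rat := p%:R - g%:R^-1.

Lemma gcdn_pfactor p c m : prime p -> (0 < m)%N ->
  gcdn m (p ^ c) = (p ^ minn (logn p m) c)%N.
Proof.
move=> p_pr m_gt0; have pc_gt0 : (0 < p ^ c)%N by rewrite expn_gt0 prime_gt0.
have /(dvdn_pfactor _ _ p_pr)[e _ def_g] := dvdn_gcdr m (p ^ c).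
have := logn_gcd p m_gt0 pc_gt0; rewrite def_g !pfactorK // => ->.
by [].
Qed.

(** Below the cap the gcd is the exact p-part and equality holds; at the cap the valuation is
    unknown, and p is the supremum over all valuations. *)
Lemma abund_le_upper_fac p c m : prime p -> (0 < m)%N ->
  abund (p ^ logn p m) * (p%:R - 1) <= upper_fac p (p ^ c) (gcdn m (p ^ c)).
Proof.
move=> p_pr m_gt0; rewrite abund_pfactor // /upper_fac gcdn_pfactor //.
rewrite eqn_exp2l ?prime_gt1 //; case: eqP => [_|/eqP].
  by rewrite lerBlDr lerDl invr_ge0.
by rewrite /minn; case: ltnP; rewrite ?eqxx.
Qed.

Lemma lower_fac_le_abund p c m : prime p -> (0 < m)%N ->
  lower_fac p (gcdn m (p ^ c)) <= abund (p ^ logn p m) * (p%:R - 1).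
Proof.
move=> p_pr m_gt0; rewrite abund_pfactor // /lower_fac gcdn_pfactor //.
rewrite lerD2l lerN2 lef_pV2 ?posrE ?ltr0n ?expn_gt0 ?prime_gt0 //.
by rewrite ler_nat leq_pexp2l ?prime_gt0 // geq_minl.
Qed.

Lemma abund_factor (ps : seq nat) m : (0 < m)%N -> uniq ps -> all prime ps ->
  exists r, [/\ (r %| m)%N, {in ps, forall p, ~~ (p %| r)%N} &
    abund m = \prod_(p <- ps) abund (p ^ logn p m) * abund r].
Proof.
move=> m_gt0 uniq_ps prime_ps.
(* The induction also needs r to keep the valuations of m outside [ps], so that the p-part split off
   next is still that of m. *)
suff [r [dvd_r r_ps _ eq_m]] : exists r, [/\ (r %| m)%N,
    {in ps, forall p, ~~ (p %| r)%N},
    forall p, p \notin ps -> logn p r = logn p m &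
    abund m = \prod_(p <- ps) abund (p ^ logn p m) * abund r].
  by exists r.
elim: ps uniq_ps prime_ps => [|p ps IHps] /=.
  by exists m; rewrite big_nil mul1r.
case/andP=> p_ps /IHps{}IHps /andP[p_pr /IHps[r [dvd_r r_ps logn_r ->]]].
have r_gt0 := dvdn_gt0 m_gt0 dvd_r.
exists (r`_p^')%N; split.
- exact: dvdn_trans (dvdn_part _ _) dvd_r.
- move=> q; rewrite inE => /orP[/eqP-> | q_ps].
    rewrite -(@p'natE p) //; exact: part_pnat.
  by apply: contra (r_ps q q_ps) => /dvdn_trans; apply; apply: dvdn_part.
- move=> q; rewrite inE negb_or => /andP[q_p q_ps].
  rewrite -logn_r // -{2}(partnC p r_gt0) lognM ?part_gt0 //.
  by rewrite p_part lognX (logn_prime q p_pr) (negbTE q_p) muln0.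
rewrite big_cons -logn_r // -p_part mulrAC mulrC; congr (_ * _).
by rewrite -abundM ?part_gt0 ?coprime_partC // partnC.
Qed.

(** * Large prime factors *)

Definition rough_sum (Y Q m : nat) : rat :=
  \sum_(1 <= d < Y.+1 | (Q < d)%N && (d %| m)%N) d%:R^-1.

(** A divisor d > 1 of r exceeds Q, since its least prime factor does. *)
Lemma rough_abund_le m Y Q r : (0 < m <= Y)%N -> (r %| m)%N ->
  (forall p, prime p -> (p <= Q)%N -> ~~ (p %| r)%N) ->
  abund r <= 1 + rough_sum Y Q m.
Proof.
move=> /andP[m_gt0 lemY] dvd_r rough_r; have r_gt0 := dvdn_gt0 m_gt0 dvd_r.
have ltrY : (r < Y.+1)%N by rewrite ltnS (leq_trans (dvdn_leq _ dvd_r)).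
rewrite abund_sum // (@big_divisors r Y.+1) ?r_gt0 // /rough_sum.
have Y_gt0 : (1 < Y.+1)%N by rewrite ltnS (leq_trans m_gt0).
rewrite big_ltn_cond // dvd1n invr1 lerD2l.
rewrite big_mkcond [leRHS]big_mkcond (@big_cat_nat _ _ _ 2 1 Y.+1) //=.
rewrite -[leLHS]add0r lerD //.
  by apply: sumr_ge0 => d _; case: ifP => // _; rewrite invr_ge0.
rewrite !big_nat; apply: ler_sum => d /andP[d_gt1 _].
case: ifP => [dvd_d | _]; last by case: ifP => // _; rewrite invr_ge0.
rewrite (dvdn_trans dvd_d dvd_r) andbT ltnNge.
case: leqP => //= ledQ.
have := rough_r (pdiv d) (pdiv_prime d_gt1).
rewrite (dvdn_trans (pdiv_dvd d) dvd_d) /= => abs.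
suff: ~~ true by []; apply: abs.
by apply: leq_trans (pdiv_leq _) ledQ; apply: ltnW.
Qed.

Lemma sum_inv_sqr_le Q N : (0 < Q)%N ->
  \sum_(Q.+1 <= d < N) (d%:R ^- 2 : rat) <= Q%:R^-1.
Proof.
move=> Q_gt0; have [leNQ | ltQN] := leqP N Q.+1; first by rewrite big_geq ?invr_ge0.
(* The stronger telescoped bound is the one that passes through the induction: 1/d^2 <= 1/(d-1) -
   1/d. *)
suff: \sum_(Q.+1 <= d < N) (d%:R ^- 2 : rat) <= Q%:R^-1 - N.-1%:R^-1.
  by move/le_trans; apply; rewrite lerBlDr lerDl invr_ge0.
elim: N ltQN => // N IHN; rewrite ltnS leq_eqVlt => /predU1P[<- | ltQN].
  rewrite big_nat1 /=; set q := Q%:R; have q0 : 0 < q by rewrite ltr0n.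
  rewrite -natr1 -/q -subr_ge0.
  have -> : q^-1 - (q + 1)^-1 - (q + 1) ^- 2 = q^-1 * (q + 1) ^- 2.
    have [q_neq0 q1_neq0] : q != 0 /\ q + 1 != 0 by rewrite !gt_eqF ?addr_gt0.
    by field; rewrite ?q_neq0 ?q1_neq0.
  by rewrite mulr_ge0 ?invr_ge0 ?exprn_ge0 ?addr_ge0 // ltW.
rewrite big_nat_recr //= -?lerBrDr; last exact: ltnW.
apply: le_trans (IHN ltQN) _; case: N ltQN {IHN} => // N ltQN /=.
have n0 : 0 < N%:R :> rat by rewrite ltr0n; lia.
rewrite -natr1; set n := N%:R in n0 *; rewrite -subr_ge0.
have -> : Q%:R^-1 - (n + 1)^-1 - (n + 1) ^- 2 - (Q%:R^-1 - n^-1) = n^-1 * (n + 1) ^- 2.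
  have [n_neq0 n1_neq0] : n != 0 /\ n + 1 != 0 by rewrite !gt_eqF ?addr_gt0.
  have Q_neq0 : Q%:R != 0 :> rat by rewrite pnatr_eq0 -lt0n.
  by field; rewrite ?n_neq0 ?n1_neq0 ?Q_neq0.
by rewrite mulr_ge0 ?invr_ge0 ?exprn_ge0 ?addr_ge0 // ltW.
Qed.

Lemma count_dvd_le (f : nat -> nat) (s : seq nat) Y d : injective f -> uniq s ->
  {in s, forall n, (0 < f n <= Y)%N} -> (count (fun n => d %| f n) s <= Y %/ d)%N.
Proof.
move=> inj_f uniq_s f_s.
have -> : (Y %/ d = count (dvdn d) (iota 1 Y))%N.
  rewrite divn_count_dvd -sum1_count [RHS]big_mkcond /index_iota subn1.
  by apply: eq_bigr => i _; case: dvdn.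
rewrite -(count_map f (dvdn d)) -!size_filter; apply: uniq_leq_size.
  by rewrite filter_uniq ?map_inj_uniq.
move=> m; rewrite !mem_filter => /andP[-> /mapP[n n_s ->]].
by rewrite mem_iota add1n ltnS f_s.
Qed.

(** Markov's inequality. The common range of d, up to Y for all n, allows the two sums to be
    exchanged; a given d > Q then divides f n for at most Y / d values of n and contributes at most
    Y / d^2. *)
Lemma count_rough_le (f : nat -> nat) x Y Q (e : rat) : (0 < Q)%N -> injective f ->
  (forall n, (0 < n <= x)%N -> (0 < f n <= Y)%N) ->
  (count (fun n => e <= rough_sum Y Q (f n)) (iota 1 x))%:R * e <= Y%:R / Q%:R.
Proof.
move=> Q_gt0 inj_f f_s.
have T_ge0 n : 0 <= rough_sum Y Q (f n) by apply: sumr_ge0 => d _; rewrite invr_ge0.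
apply: (@le_trans _ _ (\sum_(n <- iota 1 x) rough_sum Y Q (f n))).
  rewrite -sum1_count natr_sum mulr_suml big_mkcond; apply: ler_sum => n _.
  by case: ifP; rewrite ?mul1r.
under eq_bigr => n _ do rewrite /rough_sum big_mkcond.
rewrite exchange_big /=; apply: (@le_trans _ _ (Y%:R * \sum_(Q.+1 <= d < Y.+1) d%:R ^- 2)).
  rewrite (big_nat_widenl Q.+1 1) // [X in _ <= _ * X]big_mkcond mulr_sumr !big_nat.
 apply: ler_sum => d /andP[d_gt0 _]; rewrite /=.
  case: (ltnP Q d) => [ltQd | _]; last by rewrite big1 ?mulr0.
  have d0 : 0 < d%:R :> rat by rewrite ltr0n.
  rewrite -big_mkcond -big_filter big_const_seq count_predT iter_addr_0 size_filter.
  rewrite -[leLHS]mulr_natl expr2 invfM mulrA ler_pM2r ?invr_gt0 // ler_pdivlMr //.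
  rewrite -natrM ler_nat; apply: leq_trans (leq_divM Y d); rewrite leq_mul2r.
  apply/orP; right; apply: count_dvd_le => //; first exact: iota_uniq.
  by move=> n; rewrite mem_iota add1n ltnS => /f_s.
by rewrite ler_wpM2l // sum_inv_sqr_le.
Qed.

(** * Averages over a period *)

(** Chinese remainder theorem: the map to pairs of residues is injective between sets of equal
    size. *)
Lemma sum_chinese q M (H : nat -> nat -> rat) : coprime q M -> (0 < q)%N -> (0 < M)%N ->
  \sum_(n < q * M) H (n %% q)%N (n %% M)%N = \sum_(i < q) \sum_(j < M) H i j.
Proof.
move=> co_qM q_gt0 M_gt0.
pose red (n : 'I_(q * M)) := (Ordinal (ltn_pmod n q_gt0), Ordinal (ltn_pmod n M_gt0)).
have red_inj : injective red.
  move=> m n [eq_q eq_M]; apply/val_inj => /=.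
  rewrite -(modn_small (ltn_ord m)) -(modn_small (ltn_ord n)).
  by rewrite (chinese_mod co_qM m) (chinese_mod co_qM n) eq_q eq_M.
have red_bij : bijective red.
  by apply: inj_card_bij red_inj _; rewrite card_prod !card_ord.
by rewrite pair_big (reindex red) //=; apply: onW_bij.
Qed.

(* A prime, a power of it capping the valuations that are told apart, and the
   multiplicities with which pairs of gcds with that power occur in a period. *)
Definition block : Type := nat * nat * seq (nat * (nat * nat)).
Definition bprime (b : block) : nat := b.1.1.
Definition bmod (b : block) : nat := b.1.2.
Definition bkeys (b : block) := b.2.

(** 4n + s belongs to the numerator and 4n + s' to the denominator: (s, s') is (1, 0) for A(4,1,0)
    and (0, 1) for its complement. *)
Definition key (s s' q n : nat) := (gcdn (4 * n + s) q, gcdn (4 * n + s') q).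

Definition block_ok (s s' : nat) (b : block) :=
  [/\ prime (bprime b), exists c, bmod b = (bprime b ^ c)%N &
    perm_eq [seq key s s' (bmod b) i | i <- iota 0 (bmod b)]
            (flatten [seq nseq k.1 k.2 | k <- bkeys b])].

Definition factor (b : block) (k : nat * nat) : rat :=
  upper_fac (bprime b) (bmod b) k.1 / lower_fac (bprime b) k.2.

Definition ratio (s s' : nat) (bs : seq block) (n : nat) : rat :=
  \prod_(b <- bs) factor b (key s s' (bmod b) n).

Definition period (bs : seq block) : nat := \prod_(b <- bs) bmod b.

(** The proportion of residues n modulo the period with t * ratio >= 1, computed by conditioning on
    the first block; [count_prob] makes this precise. *)
Fixpoint prob (bs : seq block) (t : rat) : rat :=
  if bs is b :: bs' then
    (\sum_(k <- bkeys b) k.1%:R * prob bs' (t * factor b k.2)) / (bmod b)%:R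
  else (1 <= t)%R%:R.

Lemma bmod_gt0 s s' b : block_ok s s' b -> (0 < bmod b)%N.
Proof. by case=> p_pr [c ->] _; rewrite expn_gt0 prime_gt0. Qed.

Lemma sum_keys s s' b (F : nat * nat -> rat) : block_ok s s' b ->
  \sum_(i < bmod b) F (key s s' (bmod b) i) = \sum_(k <- bkeys b) k.1%:R * F k.2.
Proof.
case=> _ _ perm_k; rewrite -(big_mkord xpredT (fun i => F (key s s' (bmod b) i))).
rewrite /index_iota subn0 -(big_map _ xpredT F) (perm_big _ perm_k) /=.
rewrite big_flatten big_map; apply: eq_bigr => k _.
by rewrite big_nseq iter_addr_0 mulr_natl.
Qed.

Lemma sum_bkeys s s' b : block_ok s s' b -> \sum_(k <- bkeys b) k.1%:R = (bmod b)%:R :> rat.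
Proof.
move=> ok_b; have := sum_keys (fun=> 1) ok_b.
by rewrite sumr_const card_ord => ->; apply: eq_bigr => k _; rewrite mulr1.
Qed.

Lemma key_modn s s' q m n : (q %| m)%N -> key s s' q (n %% m) = key s s' q n.
Proof.
move=> dvd_qm; suff eq_g r : gcdn (4 * (n %% m) + r) q = gcdn (4 * n + r) q.
  by rewrite /key !eq_g.
rewrite -gcdn_modl -[RHS]gcdn_modl; congr (gcdn _ _).
by rewrite -modnDml -modnMmr modn_dvdm // modnMmr modnDml.
Qed.

Lemma ratio_modn s s' bs m n : (period bs %| m)%N -> ratio s s' bs (n %% m) = ratio s s' bs n.
Proof.
rewrite /ratio /period; elim: bs => [|b bs IHbs]; first by rewrite !big_nil.
rewrite !big_cons => dvd_m; rewrite key_modn; last exact: dvdn_trans (dvdn_mulr _ _) dvd_m.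
by rewrite IHbs //; apply: dvdn_trans (dvdn_mull _ _) dvd_m.
Qed.

Lemma coprime_period s s' b bs : block_ok s s' b -> {in bs, forall c, block_ok s s' c} ->
  bprime b \notin map bprime bs -> coprime (bmod b) (period bs).
Proof.
case=> b_pr [c ->] _; rewrite /period; elim: bs => [|d bs IHbs] ok_bs /=.
  by rewrite big_nil coprimen1.
rewrite inE negb_or big_cons coprimeMr => /andP[b_d /IHbs->]; last first.
  by move=> e e_bs; apply: ok_bs; rewrite inE e_bs orbT.
have [d_pr [e ->] _] := ok_bs d (mem_head d bs).
by rewrite andbT coprimeXl // coprimeXr // prime_coprime // dvdn_prime2.
Qed.

Lemma period_gt0 s s' bs : {in bs, forall b, block_ok s s' b} -> (0 < period bs)%N.
Proof.
by move=> ok_bs; rewrite /period big_seq; apply: prodn_cond_gt0 => b /ok_bs/bmod_gt0.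
Qed.

(** By [sum_chinese], the key at b and the ratio over the other blocks vary independently over a
    period. *)
Lemma count_prob s s' bs t : {in bs, forall b, block_ok s s' b} ->
  uniq (map bprime bs) ->
  \sum_(n < period bs) (1 <= t * ratio s s' bs n)%R%:R = (period bs)%:R * prob bs t.
Proof.
elim: bs t => [|b bs IHbs] t ok_bs /=.
  by rewrite /period /ratio !big_nil big_ord1 big_nil mulr1 mul1r.
have ok_b := ok_bs b (mem_head b bs).
have {}ok_bs : {in bs, forall b, block_ok s s' b}.
  by move=> e e_bs; apply: ok_bs; rewrite inE e_bs orbT.
case/andP=> b_bs uniq_bs; have b_gt0 := bmod_gt0 ok_b.
have -> : period (b :: bs) = (bmod b * period bs)%N by rewrite /period big_cons.
pose G i j : rat := (1 <= t * factor b (key s s' (bmod b) i) * ratio s s' bs j)%R%:R.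
transitivity (\sum_(n < bmod b * period bs) G (n %% bmod b)%N (n %% period bs)%N).
  apply: eq_bigr => n _; rewrite /G key_modn // ratio_modn // /ratio big_cons.
  by rewrite mulrA.
rewrite sum_chinese ?(coprime_period ok_b) ?(period_gt0 ok_bs) //.
transitivity (\sum_(i < bmod b)
    (period bs)%:R * prob bs (t * factor b (key s s' (bmod b) i))).
  by apply: eq_bigr => i _; rewrite -IHbs.
rewrite -mulr_sumr (sum_keys (fun k => prob bs (t * factor b k)) ok_b) natrM.
by rewrite [RHS]mulrC mulrA divfK ?pnatr_eq0 -?lt0n // mulrC.
Qed.

Lemma factor_ge0 b k : prime (bprime b) -> 0 <= factor b k.
Proof.
(* The case g = 0 relies on the convention that the inverse of 0 is 0. *)
move=> p_pr; have inv_le1 g : (g%:R : rat)^-1 <= 1.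
  by case: g => [|g]; rewrite ?invr0 // invf_le1 ?ltr0n // ler1n.
have p_ge1 : 1 <= (bprime b)%:R :> rat by rewrite ler1n prime_gt0.
rewrite /factor /upper_fac /lower_fac divr_ge0 ?subr_ge0 ?(le_trans (inv_le1 _)) //.
by case: ifP => _; rewrite ?subr_ge0 ?(le_trans (inv_le1 _)).
Qed.

Definition moment (k : nat) (b : block) : rat :=
  (\sum_(x <- bkeys b) x.1%:R * factor b x.2 ^+ k) / (bmod b)%:R.

(** Markov's inequality for k-th powers: the indicator of 1 <= x is at most x^k, and the moments of
    independent factors multiply. *)
Lemma prob_le_moment bs k t : all prime (map bprime bs) -> 0 <= t ->
  prob bs t <= t ^+ k * \prod_(b <- bs) moment k b.
Proof.
elim: bs t => [|b bs IHbs] t /=.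
  rewrite big_nil mulr1 => _ t_ge0; case: (leP 1 t) => [t_ge1 | _] /=.
    exact: exprn_ege1.
  exact: exprn_ge0.
case/andP=> b_pr bs_pr t_ge0; rewrite big_cons /moment mulrA [_ * (_ / _)]mulrA mulrAC.
rewrite ler_wpM2r ?invr_ge0 // mulr_sumr mulr_suml; apply: ler_sum => x _.
apply: le_trans (ler_wpM2l (ler0n _ _) (IHbs _ bs_pr (mulr_ge0 t_ge0 (factor_ge0 x.2 b_pr)))) _.
by rewrite exprMn le_eqVlt; apply/orP; left; apply/eqP; ring.
Qed.

Lemma prob_le1 s s' bs t : {in bs, forall b, block_ok s s' b} -> prob bs t <= 1.
Proof.
elim: bs t => [|b bs IHbs] t ok_bs /=; first by case: (1 <= t).
have ok_b := ok_bs b (mem_head b bs).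
rewrite ler_pdivrMr ?ltr0n ?(bmod_gt0 ok_b) // mul1r -(sum_bkeys ok_b).
apply: ler_sum => k _; rewrite ler_piMr // IHbs // => e e_bs.
by apply: ok_bs; rewrite inE e_bs orbT.
Qed.

(** Both abundancies are split into the primes of the blocks and a rough rest. The rest of 4n + s is
    at most 1 + e and that of 4n + s' at least 1; with the 1 + e of the hypothesis this gives the
    square. *)
Lemma ratio_ge1 s s' bs Y Q n (e : rat) : {in bs, forall b, block_ok s s' b} ->
  uniq (map bprime bs) -> (forall p, prime p -> (p <= Q)%N -> p \in map bprime bs) ->
  (0 < n)%N -> (4 * n + s <= Y)%N -> 0 <= e ->
  abund (4 * n + s') <= abund (4 * n + s) * (1 + e) -> rough_sum Y Q (4 * n + s) < e ->
  1 <= (1 + e) ^+ 2 * ratio s s' bs n.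
Proof.
move=> ok_bs uniq_bs bs_Q n_gt0 leY e_ge0 le_ab rough_e.
have pr_bs : all prime (map bprime bs).
  by apply/allP => _ /mapP[b /ok_bs[b_pr _ _] ->].
have a_gt0 : (0 < 4 * n + s)%N by lia.
have b_gt0 : (0 < 4 * n + s')%N by lia.
have [r [dvd_r r_bs def_a]] := abund_factor a_gt0 uniq_bs pr_bs.
have [r' [dvd_r' _ def_b]] := abund_factor b_gt0 uniq_bs pr_bs.
have r_le : abund r <= 1 + e.
  apply: le_trans (@rough_abund_le _ Y Q _ _ dvd_r _) _; first by rewrite a_gt0 leY.
    by move=> p p_pr lepQ; apply: r_bs; apply: bs_Q.
  by rewrite lerD2l ltW.
have r'_ge1 : 1 <= abund r'.
  by rewrite -abund1 abund_dvd ?dvd1n // (dvdn_gt0 b_gt0).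
have prod_gt0 m : 0 < \prod_(p <- map bprime bs) abund (p ^ logn p m).
  rewrite big_seq; apply: prodr_gt0 => p /(allP pr_bs) p_pr.
  by rewrite abund_gt0 // expn_gt0 prime_gt0.
have low_gt0 b : b \in bs -> 0 < lower_fac (bprime b) (key s s' (bmod b) n).2.
  move=> /ok_bs[p_pr _ _]; rewrite /lower_fac subr_gt0.
  apply: (@le_lt_trans _ _ 1); last by rewrite ltr1n prime_gt1.
  by rewrite invf_le1 ?ltr0n ?ler1n gcdn_gt0 b_gt0.
have -> : ratio s s' bs n = \prod_(b <- bs) upper_fac (bprime b) (bmod b) (key s s' (bmod b) n).1
    / \prod_(b <- bs) lower_fac (bprime b) (key s s' (bmod b) n).2.
  by rewrite /ratio prodf_div.
have den_gt0 : 0 < \prod_(b <- bs) lower_fac (bprime b) (key s s' (bmod b) n).2.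
  by rewrite big_seq; apply: prodr_gt0.
rewrite mulrA ler_pdivlMr // mul1r.
(* D restores the factors p - 1 that [upper_fac] and [lower_fac] carry. *)
pose D : rat := \prod_(b <- bs) ((bprime b)%:R - 1).
have D_ge0 : 0 <= D.
  rewrite /D big_seq; apply: prodr_ge0 => b /ok_bs[p_pr _ _].
  by rewrite subr_ge0 ler1n prime_gt0.
have low : \prod_(b <- bs) lower_fac (bprime b) (key s s' (bmod b) n).2
    <= \prod_(p <- map bprime bs) abund (p ^ logn p (4 * n + s')) * D.
  rewrite big_map -big_split /= !big_seq; apply: ler_prod => b b_bs.
  rewrite ltW ?low_gt0 //=; have [p_pr [c ->] _] := ok_bs b b_bs.
  exact: lower_fac_le_abund.
have upp : \prod_(p <- map bprime bs) abund (p ^ logn p (4 * n + s)) * D <=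
    \prod_(b <- bs) upper_fac (bprime b) (bmod b) (key s s' (bmod b) n).1.
  rewrite big_map -big_split /= !big_seq; apply: ler_prod => b b_bs.
  have [p_pr [c ->] _] := ok_bs b b_bs; rewrite abund_le_upper_fac // andbT.
  rewrite mulr_ge0 ?subr_ge0 ?ler1n ?prime_gt0 //.
  by rewrite ltW // abund_gt0 // expn_gt0 prime_gt0.
apply: le_trans low _; apply: le_trans (ler_wpM2l _ upp); last first.
  by rewrite exprn_ge0 // addr_ge0.
rewrite mulrA ler_wpM2r //.
set Pa := \prod_(p <- _) _ in def_a *; set Pb := \prod_(p <- _) _ in def_b *.
have Pa_gt0 : 0 < Pa := prod_gt0 _; have Pb_gt0 : 0 < Pb := prod_gt0 _.
have : Pb <= Pa * abund r * (1 + e).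
  by apply: le_trans (le_trans _ le_ab) _; rewrite ?def_b ?def_a // ler_peMr // ltW.
move/le_trans; apply; have -> : (1 + e) ^+ 2 * Pa = Pa * (1 + e) * (1 + e) by ring.
by rewrite ler_wpM2r ?addr_ge0 // ler_pM2l.
Qed.

Lemma sum_periodic (f : nat -> rat) M k :
  (forall n, f (n %% M)%N = f n) -> (0 < M)%N ->
  \sum_(0 <= n < k * M) f n = k%:R * \sum_(n < M) f n.
Proof.
move=> per_f M_gt0; elim: k => [|k IHk]; first by rewrite mul0n big_geq // mul0r.
rewrite mulSn addnC (@big_cat_nat _ _ _ (k * M)) ?leq_addr //= IHk.
rewrite -natr1 mulrDl mul1r; congr (_ + _).
rewrite -{1}[(k * M)%N]add0n big_addn addKn big_mkord.
by apply: eq_bigr => i _; rewrite -per_f addnC modnMDl per_f.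
Qed.

Lemma count_ratio_le s s' bs t x : {in bs, forall b, block_ok s s' b} ->
  uniq (map bprime bs) ->
  (count (fun n => 1 <= t * ratio s s' bs n) (iota 1 x))%:R
    <= (x + period bs)%:R * prob bs t.
Proof.
move=> ok_bs uniq_bs; have M_gt0 := period_gt0 ok_bs.
have prob_ge0 : 0 <= prob bs t.
  rewrite -(@pmulr_rge0 _ (period bs)%:R) ?ltr0n // -(count_prob t ok_bs) //.
  exact: sumr_ge0.
(* These k full periods cover 1, ..., x and have total length at most x + period. *)
pose k := (x %/ period bs).+1.
have ltxk : (x < k * period bs)%N by rewrite /k ltn_ceil.
pose F n : rat := (1 <= t * ratio s s' bs n)%R%:R.
have F_ge0 i j : 0 <= \sum_(i <= n < j) F n by apply: sumr_ge0.
have -> : (count (fun n => 1 <= t * ratio s s' bs n) (iota 1 x))%:R = \sum_(1 <= n < x.+1) F n.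
  rewrite /index_iota subn1 /= -sum1_count natr_sum big_mkcond.
  by apply: eq_bigr => n _; rewrite /F; case: ifP.
apply: (@le_trans _ _ (\sum_(0 <= n < k * period bs) F n)).
  rewrite (@big_cat_nat _ _ _ 1 0) //=; last by apply: leq_ltn_trans ltxk.
  by rewrite (@big_cat_nat _ _ _ x.+1 1 (k * _)) //= -[leLHS]add0r lerD // lerDl.
rewrite sum_periodic //; last by move=> n; rewrite /F ratio_modn.
rewrite count_prob // mulrA -natrM ler_wpM2r // ler_nat /k mulSn addnC leq_add2r.
exact: leq_divM.
Qed.

(** Either the rough sum of 4n + s reaches e, which [count_rough_le] makes rare, or [ratio_ge1]
    applies. *)
Lemma count_abund_le s s' bs Q x (e : rat) : {in bs, forall b, block_ok s s' b} ->
  uniq (map bprime bs) -> (forall p, prime p -> (p <= Q)%N -> p \in map bprime bs) ->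
  (0 < Q)%N -> 0 < e ->
  (count (fun n => abund (4 * n + s') <= abund (4 * n + s) * (1 + e)) (iota 1 x))%:R
    <= (x + period bs)%:R * prob bs ((1 + e) ^+ 2) + (4 * x + s)%:R / Q%:R / e.
Proof.
move=> ok_bs uniq_bs bs_Q Q_gt0 e_gt0; pose Y := (4 * x + s)%N.
pose A n := 1 <= (1 + e) ^+ 2 * ratio s s' bs n.
pose B n := e <= rough_sum Y Q (4 * n + s).
apply: (@le_trans _ _ ((count A (iota 1 x))%:R + (count B (iota 1 x))%:R)).
  rewrite -natrD ler_nat -count_predUI; apply: leq_trans (leq_addr _ _).
  rewrite -!size_filter; apply: uniq_leq_size; first by rewrite filter_uniq ?iota_uniq.
  move=> n; rewrite !mem_filter mem_iota add1n ltnS.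
  move=> /andP[le_ab /andP[n_gt0 lenx]]; rewrite n_gt0 lenx andbT.
  rewrite /= /A /B; case: (leP e (rough_sum _ _ _)) => [_|rough_e]; first by rewrite orbT.
  by rewrite (@ratio_ge1 _ _ _ Y Q) // ?ltW // /Y leq_add2r leq_mul2l.
apply: lerD; first exact: count_ratio_le.
rewrite ler_pdivlMr //; apply: count_rough_le => // [m n /eqP|n /andP[n_gt0 lenx]].
  by rewrite eqn_add2r eqn_mul2l => /eqP.
by rewrite /Y leq_add2r leq_mul2l lenx; lia.
Qed.

(** * Moments *)

Definition flip (b : block) : block :=
  (bprime b, bmod b, [seq (k.1, (k.2.2, k.2.1)) | k <- bkeys b]).

Lemma flip_ok s s' b : block_ok s s' b -> block_ok s' s (flip b).
Proof.
case=> b_pr b_pow perm_b; split=> //=.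
have flatten_flip ks : [seq (k.2, k.1) | k <- flatten [seq nseq k.1 k.2 | k <- ks]]
    = flatten [seq nseq k.1 k.2 | k <- [seq (k.1, (k.2.2, k.2.1)) | k <- ks]]
      :> seq (nat * nat).
  by elim: ks => //= k ks <-; rewrite map_cat map_nseq.
have := perm_map (fun k => (k.2, k.1)) perm_b.
by rewrite flatten_flip -!map_comp.
Qed.

(** The valuation is capped at 1: modulo p, one residue makes 4n + 1 divisible, another makes 4n
    divisible, and the remaining p - 2 give the factor 1. *)
Definition prime_block (p : nat) : block :=
  (p, p, [:: (p - 2, (1, 1)); (1, (p, 1)); (1, (1, p))])%N.

Lemma prime_block_ok p : prime p -> odd p -> block_ok 1 0 (prime_block p).
Proof.
move=> p_pr p_odd; split=> //=; first by exists 1%N; rewrite expn1.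
have p_gt1 := prime_gt1 p_pr; have p_gt0 := ltnW p_gt1.
have co_4p : coprime 4 p by rewrite (@coprimeXl 2 2) // coprime2n.
(* The root of 4i + 1 modulo p: for odd p, p * (p mod 4) is 1 modulo 4, so the division is exact. *)
pose i0 := ((p * (p %% 4) - 1) %/ 4)%N.
have [k0 def_i0] : exists k, (4 * i0 + 1 = p * k)%N.
  exists (p %% 4)%N; rewrite /i0.
  have [p4 | p4] : (p %% 4 = 1 \/ p %% 4 = 3)%N by lia.
    by rewrite p4; lia.
  by rewrite p4; lia.
have ltip : (i0 < p)%N.
  rewrite /i0; have : (p %% 4 < 4)%N by rewrite ltn_pmod.
  by rewrite ltn_divLR //; nia.
have i0_gt0 : (0 < i0)%N.
  rewrite lt0n; apply/eqP => i00; move: def_i0; rewrite i00 => /esym/eqP.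
  by rewrite muln_eq1 => /andP[/eqP p1 _]; rewrite p1 in p_gt1.
have gcd_p m : gcdn m p = if (p %| m)%N then p else 1%N.
  case: ifP => [/gcdn_idPr // | p_m]; apply/eqP.
  by rewrite -/(coprime m p) coprime_sym prime_coprime // p_m.
have dvd0 i : (i < p)%N -> (p %| 4 * i + 0)%N = (i == 0%N).
  move=> ltip'; rewrite addn0 Gauss_dvdr 1?coprime_sym //.
  by case: i ltip' => [|i] ltip'; rewrite ?dvdn0 // gtnNdvd.
have dvd1 i : (i < p)%N -> (p %| 4 * i + 1)%N = (i == i0).
  move=> ltip'; apply/idP/eqP => [dvd_i | ->]; last by rewrite def_i0 dvdn_mulr.
  have dvd_i0 : (p %| 4 * i0 + 1)%N by rewrite def_i0 dvdn_mulr.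
  have cancel j k : (j <= k < p)%N -> (p %| 4 * j + 1)%N -> (p %| 4 * k + 1)%N -> j = k.
    move=> /andP[lejk ltkp] dvd_j dvd_k.
    have : (p %| 4 * (k - j))%N.
      by rewrite (_ : 4 * (k - j) = 4 * k + 1 - (4 * j + 1))%N ?dvdn_sub //; lia.
    rewrite Gauss_dvdr 1?coprime_sym //; case def_d: (k - j)%N => [|d]; first by lia.
    by rewrite gtnNdvd //; lia.
  case: (leqP i i0) => [lei | /ltnW lei]; first by apply: cancel; rewrite ?lei.
  by apply/esym/cancel; rewrite ?lei.
have perm_iota : perm_eq (iota 0 p) [:: 0, i0 & rem i0 (rem 0 (iota 0 p))]%N.
  apply: perm_trans (perm_to_rem (_ : 0 \in iota 0 p)) _; first by rewrite mem_iota; lia.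
  rewrite perm_cons perm_to_rem // mem_rem_uniq ?iota_uniq // inE mem_iota.
  by rewrite -lt0n i0_gt0.
apply: perm_trans (perm_map _ perm_iota) _ => /=.
rewrite /key !gcd_p !dvd0 ?dvd1 ?eqxx //.
rewrite [_ == i0]eq_sym !(gtn_eqF i0_gt0).
set r := rem i0 _; have -> : [seq (gcdn (4 * i + 1) p, gcdn (4 * i + 0) p) | i <- r]
    = nseq (p - 2) (1, 1)%N.
  have sz_r : size r = (p - 2)%N.
    have := perm_size perm_iota; rewrite size_iota /= => ->.
    by rewrite -/r subn2.
  rewrite -sz_r -[in RHS](size_map (fun i => (gcdn (4 * i + 1) p, gcdn (4 * i + 0) p))).
  apply/all_pred1P/allP => k /mapP[i i_r ->].
  have /andP[i_neq0 i_neqi0] : (i != 0%N) && (i != i0).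
    move: i_r; rewrite mem_rem_uniq ?rem_uniq ?iota_uniq // inE => /andP[->].
    by rewrite mem_rem_uniq ?iota_uniq // inE => /andP[->].
  have ltip' : (i < p)%N.
    by move: i_r => /mem_rem/mem_rem; rewrite mem_iota.
  by rewrite /= !gcd_p dvd0 // dvd1 // (negbTE i_neq0) (negbTE i_neqi0).
rewrite perm_sym perm_catC /= -cat1s -[X in perm_eq _ X]cat1s.
exact: (permEl (perm_catCA [:: _] [:: _] _)).
Qed.

Lemma perm_moment_flip k b : perm_eq (bkeys (flip b)) (bkeys b) ->
  moment k (flip b) = moment k b.
Proof. by move=> perm_b; rewrite /moment (perm_big _ perm_b). Qed.

(** p times the deviation of the k-th moment of [prime_block p] from 1; the powers come from the two
    special residues. *)
Definition excess (k p : nat) : rat :=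
  (p%:R / (p%:R - 1)) ^+ k + (p%:R / (p%:R + 1)) ^+ k - 2%:R.

Lemma moment_prime_block k p : (1 < p)%N ->
  moment k (prime_block p) = 1 + excess k p / p%:R.
Proof.
move=> p_gt1; rewrite /moment /prime_block /= !big_cons big_nil /factor /=.
rewrite /upper_fac /lower_fac eqxx ltn_eqF //= invr1 /excess.
have p_gt1' : 1 < p%:R :> rat by rewrite ltr1n.
rewrite natrB //; move: p%:R p_gt1' => x x_gt1.
have [x0 x1 x2] : [/\ x != 0, x - 1 != 0 & x + 1 != 0] by split; rewrite gt_eqF //; lra.
have -> : (x - 1) / (x - 1) = 1 by rewrite mulfV.
have -> : (x - 1) / (x - x^-1) = x / (x + 1).
  have : x * x - 1 != 0 by rewrite gt_eqF //; nra.
  by move=> xx1; field; rewrite x0 x2 xx1.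
rewrite expr1n; move: (_ ^+ k) (_ ^+ k) => u v.
by field.
Qed.

(** The product of the two powers is (p^2 / (p^2 - 1))^k >= 1, so their sum is at least 2 by the
    arithmetic-geometric mean inequality. *)
Lemma excess_ge0 k p : (1 < p)%N -> 0 <= excess k p.
Proof.
move=> p_gt1; rewrite /excess.
have p_gt1' : 1 < p%:R :> rat by rewrite ltr1n.
move: p%:R p_gt1' => x x_gt1.
set a := (x / (x - 1)) ^+ k; set b := (x / (x + 1)) ^+ k.
have a_gt0 : 0 < a by rewrite exprn_gt0 // divr_gt0; lra.
have b_gt0 : 0 < b by rewrite exprn_gt0 // divr_gt0; lra.
have ab_ge1 : 1 <= a * b.
  rewrite -exprMn exprn_ege1 // mulf_div ler_pdivlMr; nra.
have sum_sqr : 4 <= (a + b) * (a + b) by have := sqr_ge0 (a - b); rewrite expr2; nra.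
by rewrite subr_ge0 leNgt; apply/negP => lt2; nra.
Qed.

(** With a, b the two k-th powers and e = a + b - 2, one has a^2 + b^2 - 2 = e^2 + 4e + 2 - 2ab.
    Here ab = q^k with q = p^2 / (p^2 - 1) >= 1 + 1/p^2, and Bernoulli's inequality gives q^k >= 1 +
    k/p^2. *)
Lemma excess_double k p A : (1 < p)%N -> excess k p <= A / p%:R ^+ 2 ->
  excess k.*2 p <= (4 * A - 2 * k%:R + A ^+ 2 / p%:R ^+ 2) / p%:R ^+ 2.
Proof.
move=> p_gt1 le_A; have e_ge0 := excess_ge0 k p_gt1.
have p_gt1' : 1 < p%:R :> rat by rewrite ltr1n.
set x := p%:R in le_A p_gt1' *; set e := excess k p in e_ge0 le_A.
pose q := x ^+ 2 / (x ^+ 2 - 1).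
have x0 : x ^+ 2 != 0 by rewrite gt_eqF //; nra.
have def_e : excess k.*2 p = 4 * e + e ^+ 2 + 2 - 2 * q ^+ k.
  have -> : q = (x / (x - 1)) * (x / (x + 1)) by rewrite /q mulf_div; congr (_ / _); ring.
  rewrite /e /excess -/x -muln2 !exprM [(_ / _ * _) ^+ k]exprMn.
  by move: ((x / (x - 1)) ^+ k) ((x / (x + 1)) ^+ k) => u v; ring.
have q_ge : 1 + k%:R / x ^+ 2 <= q ^+ k.
  have q_ge1 : 1 + (x ^+ 2)^-1 <= q.
    rewrite /q ler_pdivlMr; last by nra.
    have -> : (1 + (x ^+ 2)^-1) * (x ^+ 2 - 1) = x ^+ 2 - (x ^+ 2)^-1.
      by move: (x ^+ 2) x0 => y y0; field.
    by rewrite lerBlDr lerDl invr_ge0 sqr_ge0.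
  have inv_ge0 : 0 <= (x ^+ 2)^-1 by rewrite invr_ge0 sqr_ge0.
  elim: (k) => [|m IHm]; first by rewrite mul0r addr0 expr0.
  have m_ge0 := ler0n rat m; set i := (x ^+ 2)^-1 in q_ge1 inv_ge0 IHm *.
  apply: (@le_trans _ _ ((1 + i) * (1 + m%:R * i))).
    by rewrite -natr1; have := mulr_ge0 m_ge0 (mulr_ge0 inv_ge0 inv_ge0); lra.
  by rewrite exprS ler_pM // addr_ge0 // mulr_ge0.
rewrite def_e; set y := x ^+ 2 in x0 q_ge le_A *.
have -> : (4 * A - 2 * k%:R + A ^+ 2 / y) / y = 4 * (A / y) + (A / y) ^+ 2 - 2 * (k%:R / y).
  by field.
have : e ^+ 2 <= (A / y) ^+ 2 by rewrite ler_pXn2r // nnegrE (le_trans e_ge0).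
by move: (_ / y) (_ / y) (q ^+ k) (e ^+ 2) q_ge le_A => u v w z; lra.
Qed.

(** Put u = A * w J, v = A * w (J + 1) and let a be the new term A / J^3. Since a <= u - v, one has
    (1 + a)(1 - u) <= 1 - u + a <= 1 - v, so the bound telescopes. A prime J > 2 is odd, hence the
    restriction to odd j. *)
Lemma prod_tail_le (w : nat -> rat) (A : rat) J r :
  (forall j, (2 < j)%N -> 0 <= w j.+1 <= w j) ->
  (forall j, (2 < j)%N -> odd j -> j%:R ^- 3 <= w j - w j.+1) ->
  0 <= A -> (2 < J)%N -> A * w J <= 1 ->
  (\prod_(p <- [seq p <- iota J r | prime p]) (1 + A / p%:R ^+ 3)) * (1 - A * w J) <= 1.
Proof.
move=> w_le w_odd A_ge0; elim: r J => [|r IHr] J J_gt2 AJ /=.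
  have /andP[wS_ge0 wS_le] := w_le J J_gt2.
  by rewrite big_nil mul1r lerBlDr lerDl mulr_ge0 // (le_trans wS_ge0).
have prod_ge0 : 0 <= \prod_(p <- [seq p <- iota J.+1 r | prime p]) (1 + A / p%:R ^+ 3).
  by apply: prodr_ge0 => p _; rewrite addr_ge0 // divr_ge0 // exprn_ge0.
have AJ' : A * w J.+1 <= A * w J by rewrite ler_wpM2l //; case/andP: (w_le J J_gt2).
have {}IHr := IHr J.+1 (leqW J_gt2) (le_trans AJ' AJ).
case: ifP => [J_pr | _]; last first.
  by apply: le_trans IHr; rewrite ler_wpM2l // lerD2l lerN2.
rewrite big_cons mulrAC; apply: le_trans IHr; rewrite mulrC ler_wpM2l //.
have J_odd : odd J by case/even_prime: J_pr => // J2; rewrite J2 in J_gt2.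
have := ler_wpM2l A_ge0 (w_odd J J_gt2 J_odd); rewrite mulrBr.
have a_ge0 : 0 <= A * J%:R ^- 3 by rewrite mulr_ge0 // invr_ge0 exprn_ge0.
have u_ge0 : 0 <= A * w J.
  by rewrite mulr_ge0 //; case/andP: (w_le J J_gt2) => /le_trans; apply.
move: (A * w J) (A * w J.+1) (A * _) a_ge0 u_ge0 => u v a a_ge0 u_ge0.
by have := mulr_ge0 a_ge0 u_ge0; lra.
Qed.

(* Telescoping: tail_weight J bounds the sum of 1/j^3 over the odd j >= J. *)
Definition tail_weight (J : nat) : rat := (16%:R * J./2%:R ^+ 2)^-1.

Lemma tail_weight_succ J : (2 < J)%N -> 0 <= tail_weight J.+1 <= tail_weight J.
Proof.
move=> J_gt2; rewrite /tail_weight; apply/andP; split.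
  by rewrite invr_ge0; apply: mulr_ge0; rewrite ?exprn_ge0 ?ler0n.
have J2_gt0 : (0 < J./2)%N by rewrite half_gt0 ltnW.
have le_J : (J./2 <= J.+1./2)%N by rewrite half_leq.
move: J.+1./2 J./2 J2_gt0 le_J => m n n_gt0 len.
have n0 : 0 < n%:R :> rat by rewrite ltr0n.
have le_nm : n%:R <= m%:R :> rat by rewrite ler_nat.
move: n%:R m%:R n0 le_nm => x y x0 le_xy.
by rewrite lef_pV2 ?posrE; nra.
Qed.

(** With J = 2x + 1 the difference is J / (4x(x + 1))^2, and 4x(x + 1) = J^2 - 1. *)
Lemma tail_weight_odd J : (2 < J)%N -> odd J ->
  J%:R ^- 3 <= tail_weight J - tail_weight J.+1.
Proof.
move=> J_gt2 J_odd; rewrite /tail_weight.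
have -> : J.+1./2 = J./2.+1 by rewrite -uphalfE uphalf_half J_odd.
have -> : J%:R = J./2%:R * 2 + 1 :> rat.
  by rewrite -{1}(odd_double_half J) J_odd -muln2 natrD natrM addrC.
have J2_gt0 : 0 < J./2%:R :> rat by rewrite ltr0n half_gt0 ltnW.
rewrite -[J./2.+1%:R]natr1; move: J./2%:R J2_gt0 => x x_gt0.
have -> : (16 * x ^+ 2)^-1 - (16 * (x + 1) ^+ 2)^-1 = (2 * x + 1) / (16 * x ^+ 2 * (x + 1) ^+ 2).
  have [x0 x1] : x != 0 /\ x + 1 != 0 by rewrite !gt_eqF //; lra.
  by field; rewrite ?x0 ?x1.
rewrite ler_pdivlMr; last by rewrite !mulr_gt0 ?exprn_gt0 //; lra.
rewrite mulrC ler_pdivrMr; last by rewrite exprn_gt0 //; lra.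
rewrite -subr_ge0.
have -> : (2 * x + 1) * (x * 2 + 1) ^+ 3 - 16 * x ^+ 2 * (x + 1) ^+ 2 = 8 * x ^+ 2 + 8 * x + 1.
  by ring.
by rewrite !addr_ge0 ?mulr_ge0 ?exprn_ge0 // ltW.
Qed.

(** * Branch and bound *)

(* Fixed-point upper bounds: the natural number x stands for x / 2 ^ 24, and
   every operation rounds up. *)
Definition fix_one : N := 16777216.
Definition fix_mul (x y : N) : N := N.succ (N.shiftr (x * y) 24).
Definition fix_div (x y : N) : N := N.succ (x / y).

(* Locked, as unfolding it on a numeral would produce a unary number. *)
HB.lock Definition qN (x : N) : rat := (N.to_nat x)%:R.

Lemma qNE x : qN x = (N.to_nat x)%:R. Proof. by rewrite qN.unlock. Qed.

Lemma qN_ge0 x : 0 <= qN x. Proof. by rewrite qNE ler0n. Qed.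

Lemma qN_gt0 x : (0 < x)%num -> 0 < qN x.
Proof. by move=> x_gt0; rewrite qNE ltr0n; lia. Qed.

Lemma qN_le x y : (x <= y)%num -> qN x <= qN y.
Proof. by move=> le_xy; rewrite !qNE ler_nat; lia. Qed.

Lemma qND x y : qN (x + y) = qN x + qN y.
Proof. by rewrite !qNE -natrD; congr _%:R; lia. Qed.

Lemma qNM x y : qN (x * y) = qN x * qN y.
Proof. by rewrite !qNE -natrM; congr _%:R; lia. Qed.

Lemma qN_sub x y : (y <= x)%num -> qN (x - y) = qN x - qN y.
Proof.
move=> le_yx; have {2}-> : x = (x - y + y)%num by lia.
by rewrite qND addrK.
Qed.

Lemma qN_of_nat n : qN (N.of_nat n) = n%:R.
Proof. by rewrite qNE; congr _%:R; lia. Qed.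

Lemma qN_div_le x y : qN x / qN y <= qN (fix_div x y).
Proof.
have [->|y_gt0] : y = 0%num \/ (0 < y)%num by lia.
  by rewrite (qNE 0) /= invr0 mulr0 qN_ge0.
rewrite ler_pdivrMr ?qN_gt0 // -qNM; apply: qN_le; rewrite /fix_div.
by have := N.div_mod' x y; have := N.mod_lt x y; nia.
Qed.

Definition fixr (x : N) : rat := qN x / qN fix_one.

Lemma fix_one_gt0 : 0 < qN fix_one.
Proof. exact: qN_gt0. Qed.

Lemma fixr_ge0 x : 0 <= fixr x.
Proof. exact: divr_ge0 (qN_ge0 _) (qN_ge0 _). Qed.

Lemma fixr_le x y : (x <= y)%num -> fixr x <= fixr y.
Proof. by move=> le_xy; apply: ler_wpM2r (qN_le le_xy); rewrite invr_ge0 qN_ge0. Qed.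

Lemma fixr_one : fixr fix_one = 1.
Proof. by rewrite /fixr mulfV // gt_eqF // fix_one_gt0. Qed.

Lemma fixrD x y : fixr (x + y) = fixr x + fixr y.
Proof. by rewrite /fixr qND mulrDl. Qed.

Lemma fixrM x y : fixr (x * y) = qN x * fixr y.
Proof. by rewrite /fixr qNM mulrA. Qed.

Lemma fixr_sub_le x y : fixr x - fixr y <= fixr (x - y).
Proof. by rewrite lerBlDr -fixrD; apply: fixr_le; lia. Qed.

Lemma fixr_oneM x : fixr (fix_one * x) = qN x.
Proof. by rewrite N.mul_comm fixrM fixr_one mulr1. Qed.

Lemma fixr_mul_le x y : fixr x * fixr y <= fixr (fix_mul x y).
Proof.
have inv_ge0 : 0 <= (qN fix_one)^-1 by rewrite invr_ge0 qN_ge0.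
rewrite /fixr mulrA; apply: ler_wpM2r => //; rewrite mulrAC -qNM.
by rewrite /fix_mul N.shiftr_div_pow2; apply: qN_div_le.
Qed.

Lemma fixr_div_le x y : fixr x / qN y <= fixr (fix_div x y).
Proof.
rewrite /fixr mulrAC; apply: ler_wpM2r (qN_div_le _ _).
by rewrite invr_ge0 qN_ge0.
Qed.

(** The inverses of g and g' are cleared first, so that a single division rounds. *)
Definition factor_fix (p q g g' : N) : N :=
  let (num, den) := if (g =? q)%num then (p, 1%num) else ((p * g - 1)%num, g) in
  fix_div (fix_one * (num * g')) (den * (p * g' - 1)).

Definition block_fix (b : block) (k : nat * nat) : N :=
  factor_fix (N.of_nat (bprime b)) (N.of_nat (bmod b)) (N.of_nat k.1) (N.of_nat k.2).

Lemma block_fix_ge b k : (1 < bprime b)%N -> (0 < k.1)%N -> (0 < k.2)%N ->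
  factor b k <= fixr (block_fix b k).
Proof.
case: b => [[p q] ks] /=; case: k => [g g'] /=; move=> p_gt1 g_gt0 g'_gt0.
have p0 : 0 < p%:R :> rat by rewrite ltr0n ltnW.
have inv_lt n : (0 < n)%N -> 0 < p%:R - n%:R^-1 :> rat.
  move=> n_gt0; rewrite subr_gt0; apply: (@le_lt_trans _ _ 1); last by rewrite ltr1n.
  by rewrite invf_le1 ?ltr0n ?ler1n.
have sub_inv n : (0 < n)%N -> p%:R - n%:R^-1 = qN (N.of_nat p * N.of_nat n - 1) / n%:R :> rat.
  move=> n_gt0; have n0 : n%:R != 0 :> rat by rewrite pnatr_eq0 -lt0n.
  have -> : (N.of_nat p * N.of_nat n - 1 = N.of_nat (p * n - 1))%num by lia.
  rewrite qN_of_nat natrB ?muln_gt0 ?(ltnW p_gt1) // natrM.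
  by move: (p%:R) (n%:R) n0 => x y y0; field.
rewrite /factor /block_fix /= /factor_fix /upper_fac /lower_fac.
have -> : (N.of_nat g =? N.of_nat q)%num = (g == q) by lia.
have g0 : g%:R != 0 :> rat by rewrite pnatr_eq0 -lt0n.
have g'0 : g'%:R != 0 :> rat by rewrite pnatr_eq0 -lt0n.
have c0 : qN (N.of_nat p * N.of_nat g' - 1) != 0.
  apply: contraTneq (inv_lt g' g'_gt0) => c0.
  by rewrite (sub_inv g') // c0 mul0r ltxx.
case: (g == q); apply: le_trans (fixr_div_le _ _); rewrite fixr_oneM !qNM !qN_of_nat.
  rewrite (sub_inv g') // (qNE 1) mul1r.
  by move: (qN _) c0 => c c0; rewrite le_eqVlt; apply/orP; left; apply/eqP; field; rewrite c0 g'0.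
rewrite (sub_inv g') // (sub_inv g) //; move: (qN _) (qN _) c0 => c d d0.
by rewrite le_eqVlt; apply/orP; left; apply/eqP; field; rewrite ?d0 ?g0 ?g'0.
Qed.

Definition key_sum (b : block) (y : nat * nat -> N) : N :=
  foldr (fun k a => N.of_nat k.1 * y k.2 + a)%num 0%num (bkeys b).

(* Lists of constants refer to the exponents 2k, 4k, 8k, and so on. *)
Fixpoint moments_fix (J : nat) (b : block) (y : nat * nat -> N) : seq N :=
  if J is J'.+1 then
    let y' := fun k => fix_mul (y k) (y k) in
    fix_div (key_sum b y') (N.of_nat (bmod b)) :: moments_fix J' b y'
  else [::].

Fixpoint moments_le (bs : seq block) (k : nat) (cs : seq N) : Prop :=
  if cs is c :: cs' then
    \prod_(b <- bs) moment k.*2 b <= fixr c /\ moments_le bs k.*2 cs'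
  else True.

(** [zip] truncates to the shorter list, so an exponent survives only if both sides bound it. *)
Definition mul_consts (cs ds : seq N) : seq N := [seq fix_mul x.1 x.2 | x <- zip cs ds].

(* A is a fixed-point bound for p^2 * excess k p, p >= 200; the list stops before
   1 - A * tail_weight 200 would become nonpositive. *)
Fixpoint tail_consts (J : nat) (k A : N) : seq N :=
  if J is J'.+1 then
    let A' := (4 * A - 2 * k * fix_one + fix_div (A * A) (fix_one * 40000))%num in
    let M := (160000 * fix_one)%num in
    if (A' <? M)%num then
      fix_div (fix_one * M) (M - A') :: tail_consts J' (2 * k) A'
    else [::]
  else [::].

(** Eight doublings give the exponents 2, ..., 256. The start comes from [excess 1 p] = 2 / (p^2 -
    1) and p^2 / (p^2 - 1) <= 40000/39999 for p >= 200. *)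
Definition tail0 : seq N := tail_consts 8 1 (fix_div (80000 * fix_one) 39999).

(** The moment constants of this block together with all later ones; then its modulus and, for each
    key, the multiplicity and the factors in both directions. *)
Definition plan_step : Type := seq N * (N * seq (N * (N * N))).

Definition block_step (b : block) : N * seq (N * (N * N)) :=
  (N.of_nat (bmod b),
   [seq (N.of_nat k.1, (block_fix b k.2, block_fix b (k.2.2, k.2.1))) | k <- bkeys b]).

Definition plan_consts (tc : seq N) (pl : seq plan_step) : seq N :=
  if pl is s :: _ then s.1 else tc.

Fixpoint plan (tc : seq N) (bs : seq block) : seq plan_step :=
  if bs is b :: bs' then
    let pl := plan tc bs' in
    (mul_consts (plan_consts tc pl) (moments_fix 8 b (block_fix b)), block_step b) :: pl
  else [::].

Fixpoint leaf (T : N) (cs : seq N) (best : N) : N :=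
  if cs is c :: cs' then
    let T' := fix_mul T T in leaf T' cs' (N.min best (fix_mul T' c))
  else best.

(** A child of probability w / q gets the tolerance tau * q / w, so that gaps are compared after
    weighting by the probability of the branch. *)
Fixpoint children (f : N -> N -> N -> N * N) (q : N) (st : seq (N * (N * N))) (T U tau : N) :
    N * N :=
  if st is (w, (y, z)) :: st' then
    let: (c, d) := f (fix_mul T y) (fix_mul U z) (tau * q / w)%num in
    let: (c', d') := children f q st' T U tau in
    (w * c + c', w * d + d')%num
  else (0, 0)%num.

Definition node f (s : N * seq (N * (N * N))) (T U tau : N) : N * N :=
  let: (c, d) := children f s.1 s.2 T U tau in (fix_div c s.1, fix_div d s.1).

(* Bounds the probabilities of the two complementary events at once, branching
   over the next prime as long as the gap left by the moment bounds exceeds tau. *)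
Fixpoint search (tc : seq N) (pl : seq plan_step) (T U tau : N) : N * N :=
  let g := if (T <? U)%num then leaf T (plan_consts tc pl) fix_one
           else leaf U (plan_consts tc pl) fix_one in
  let triv := if (T <? U)%num then (g, fix_one) else (fix_one, g) in
  if pl is s :: pl' then
    if (g <=? tau)%num then triv else node (search tc pl') s.2 T U tau
  else triv.

(* As 4n is divisible by 4, the cap 64 at the prime 2 leaves five cases. *)
Definition block2 : block :=
  (2, 64, [:: (32, (1, 4)); (16, (1, 8)); (8, (1, 16)); (4, (1, 32)); (4, (1, 64))])%N.
(** A cap q at the prime p costs a relative error of at most about 1/(p q), so small primes get
    higher caps. *)
Definition block3 : block :=
  (3, 27, [:: (9, (1, 1)); (6, (3, 1)); (6, (1, 3)); (2, (9, 1)); (2, (1, 9));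
              (1, (27, 1)); (1, (1, 27))])%N.
Definition block5 : block :=
  (5, 25, [:: (15, (1, 1)); (4, (5, 1)); (4, (1, 5)); (1, (25, 1)); (1, (1, 25))])%N.

Definition odd_blocks : seq block :=
  [:: block3, block5 & [seq prime_block p | p <- iota 7 193 & prime p]].

(* (1 + slack)^2 rounded up, see slack_sqr_le. *)
Definition start : N := (fix_one + 16)%num.

(** In units of 2^-24 the results are about 0.02058 and 0.98923, below the targets 0.0207187 and 1 -
    0.0107553 = 0.9892447. The tolerance 251 is about 1.5 * 10^-5. *)
Lemma search_result :
  node (search tail0 (plan tail0 odd_blocks)) (block_step block2) start start 251
  = (345209, 16596517)%num.
Proof. by vm_compute. Qed.

(** * Soundness of the search *)

Lemma key_sum_ge k b y : {in bkeys b, forall x, factor b x.2 ^+ k <= fixr (y x.2)} ->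
  \sum_(x <- bkeys b) x.1%:R * factor b x.2 ^+ k <= fixr (key_sum b y).
Proof.
rewrite /key_sum; elim: (bkeys b) => [|x xs IHxs] le_y.
  by rewrite big_nil fixr_ge0.
rewrite big_cons /= fixrD fixrM qN_of_nat lerD //.
  by rewrite ler_wpM2l ?ler0n // le_y ?mem_head.
by apply: IHxs => z z_xs; apply: le_y; rewrite inE z_xs orbT.
Qed.

Lemma moments_fix_le J b k y : prime (bprime b) ->
  {in bkeys b, forall x, factor b x.2 ^+ k <= fixr (y x.2)} ->
  moments_le [:: b] k (moments_fix J b y).
Proof.
move=> b_pr; elim: J k y => //= J IHJ k y le_y.
have le_y' : {in bkeys b, forall x, factor b x.2 ^+ k.*2 <= fixr (fix_mul (y x.2) (y x.2))}.
  move=> x x_b; rewrite -addnn exprD; apply: le_trans (fixr_mul_le _ _).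
  by rewrite ler_pM ?exprn_ge0 ?factor_ge0 ?le_y.
split; last exact: IHJ.
rewrite big_seq1 /moment -qN_of_nat; apply: le_trans (fixr_div_le _ _).
rewrite ler_wpM2r ?invr_ge0 ?qN_ge0 //.
exact: (@key_sum_ge _ b (fun k => fix_mul (y k) (y k))).
Qed.

Lemma moment_ge0 k b : prime (bprime b) -> 0 <= moment k b.
Proof.
move=> b_pr; rewrite divr_ge0 ?ler0n // sumr_ge0 // => x _.
by rewrite mulr_ge0 ?ler0n // exprn_ge0 // factor_ge0.
Qed.

Lemma mul_consts_le b bs k cs ds : prime (bprime b) -> all prime (map bprime bs) ->
  moments_le bs k cs -> moments_le [:: b] k ds -> moments_le (b :: bs) k (mul_consts cs ds).
Proof.
move=> b_pr bs_pr; elim: cs k ds => [|c cs IHcs] k [|d ds] //= [le_c le_cs] [le_d le_ds].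
split; last exact: IHcs.
rewrite big_seq1 in le_d; rewrite big_cons mulrC; apply: le_trans (fixr_mul_le _ _).
rewrite ler_pM ?moment_ge0 // big_seq prodr_ge0 // => x x_bs.
by rewrite moment_ge0 // (allP bs_pr) // map_f.
Qed.

(** All t up to T are covered because the thresholds are rounded up on the way down. *)
Definition prob_bound (bs : seq block) (T c : N) : Prop :=
  forall t, 0 <= t <= fixr T -> prob bs t <= fixr c.

(** T majorizes t^k, so its square serves the doubled exponent, where [prob_le_moment] yields the
    next candidate for the minimum. *)
Lemma leaf_bound bs cs k T t best : all prime (map bprime bs) -> 0 <= t ->
  t ^+ k <= fixr T -> moments_le bs k cs -> prob bs t <= fixr best ->
  prob bs t <= fixr (leaf T cs best).
Proof.
move=> bs_pr t_ge0; elim: cs k T best => //= c cs IHcs k T best le_T [le_c le_cs] le_best.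
have le_TT : t ^+ k.*2 <= fixr (fix_mul T T).
  rewrite -addnn exprD; apply: le_trans (fixr_mul_le _ _).
  by rewrite ler_pM ?exprn_ge0.
apply: (IHcs k.*2) => //.
have [->|->] : N.min best (fix_mul (fix_mul T T) c) = best \/
    N.min best (fix_mul (fix_mul T T) c) = fix_mul (fix_mul T T) c by lia.
  by [].
apply: le_trans (prob_le_moment k.*2 bs_pr t_ge0) _; apply: le_trans (fixr_mul_le _ _).
rewrite ler_pM ?exprn_ge0 // big_seq prodr_ge0 // => x x_bs.
by rewrite moment_ge0 // (allP bs_pr) // map_f.
Qed.

Lemma children_bound f b ks bs bs' T U tau t u : (1 < bprime b)%N -> prime (bprime b) ->
  all (fun k => (0 < k.2.1) && (0 < k.2.2))%N ks ->
  (forall T U tau, prob_bound bs T (f T U tau).1 /\ prob_bound bs' U (f T U tau).2) ->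
  0 <= t <= fixr T -> 0 <= u <= fixr U ->
  let r := children f (N.of_nat (bmod b))
    [seq (N.of_nat k.1, (block_fix b k.2, block_fix b (k.2.2, k.2.1))) | k <- ks] T U tau in
  \sum_(k <- ks) k.1%:R * prob bs (t * factor b k.2) <= fixr r.1 /\
  \sum_(k <- ks) k.1%:R * prob bs' (u * factor b (k.2.2, k.2.1)) <= fixr r.2.
Proof.
move=> b_gt1 b_pr ks_gt0 f_ok /andP[t_ge0 le_tT] /andP[u_ge0 le_uU].
elim: ks ks_gt0 => [|[w [g g']] ks IHks] /=; first by rewrite !big_nil fixr_ge0.
case/andP=> /andP[g_gt0 g'_gt0] /IHks; case: children => c' d' /= [le_c' le_d'].
set T' := fix_mul T _; set U' := fix_mul U _; set tau' := (_ / _)%num.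
have [] := f_ok T' U' tau'; case: (f _ _ _) => c d /= le_c le_d.
have le_fac x y z v : 0 <= z -> z <= fixr v -> (0 < x)%N -> (0 < y)%N ->
    0 <= z * factor b (x, y) <= fixr (fix_mul v (block_fix b (x, y))).
  move=> z_ge0 le_zv x_gt0 y_gt0; rewrite mulr_ge0 ?factor_ge0 //.
  apply: le_trans (fixr_mul_le _ _); rewrite ler_pM ?factor_ge0 //.
  exact: block_fix_ge.
rewrite !big_cons /= !fixrD !fixrM qN_of_nat; split; apply: lerD => //.
  by rewrite ler_wpM2l ?ler0n // le_c // le_fac.
by rewrite ler_wpM2l ?ler0n // le_d // le_fac.
Qed.

Lemma node_bound f b bs T U tau : prime (bprime b) ->
  all (fun k => (0 < k.2.1) && (0 < k.2.2))%N (bkeys b) ->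
  (forall T U tau, prob_bound bs T (f T U tau).1 /\ prob_bound (map flip bs) U (f T U tau).2) ->
  let r := node f (block_step b) T U tau in
  prob_bound (b :: bs) T r.1 /\ prob_bound (map flip (b :: bs)) U r.2.
Proof.
move=> b_pr b_keys f_ok.
have bound t u :=
  @children_bound f b _ bs (map flip bs) T U tau t u (prime_gt1 b_pr) b_pr b_keys f_ok.
rewrite /node /block_step /=; move: bound; case: children => c d /= bound.
have b_ge0 : 0 <= (bmod b)%:R^-1 :> rat by rewrite invr_ge0 ler0n.
split=> [t le_t | u le_u] /=; apply: le_trans (fixr_div_le _ _).
  rewrite qN_of_nat ler_wpM2r //.
  (* [children_bound] treats both directions at once; here the other one receives the dummy
     threshold 0. *)
  by have [] := bound t 0 le_t _; rewrite ?lexx ?fixr_ge0.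
rewrite qN_of_nat big_map ler_wpM2r //.
by have [] := bound 0 u _ le_u; rewrite ?lexx ?fixr_ge0.
Qed.

Definition keys_gt0 (b : block) := all (fun k => (0 < k.2.1) && (0 < k.2.2))%N (bkeys b).

(** Symmetry under [flip] lets one list of moment constants serve both directions. It fails for
    [block2], as 4n + 1 is odd, so the computation starts by branching over 2. *)
Definition good_block (b : block) :=
  [/\ block_ok 1 0 b, keys_gt0 b & perm_eq (bkeys (flip b)) (bkeys b)].

Lemma good_primes bs : {in bs, forall b, good_block b} -> all prime (map bprime bs).
Proof. by move=> ok_bs; apply/allP => _ /mapP[b /ok_bs[[b_pr _ _] _ _] ->]. Qed.

Lemma moments_le_flip bs k cs : {in bs, forall b, good_block b} ->
  moments_le bs k cs -> moments_le (map flip bs) k cs.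
Proof.
move=> ok_bs; elim: cs k => //= c cs IHcs k [le_c /IHcs]; split=> //.
apply: le_trans le_c; rewrite big_map big_seq [leRHS]big_seq.
rewrite (eq_bigr (moment k.*2)) // => b /ok_bs[_ _ sym_b].
exact: perm_moment_flip.
Qed.

Lemma plan_consts_le tc bs tl : {in bs ++ tl, forall b, good_block b} ->
  moments_le tl 1 tc -> moments_le (bs ++ tl) 1 (plan_consts tc (plan tc bs)).
Proof.
move=> ok_bs le_tl; elim: bs ok_bs => [|b bs IHbs] ok_bs; first by [].
have {}IHbs : moments_le (bs ++ tl) 1 (plan_consts tc (plan tc bs)).
  by apply: IHbs => c c_bs; apply: ok_bs; rewrite inE c_bs orbT.
have [[b_pr _ _] b_keys _] := ok_bs b (mem_head _ _).
apply: (@mul_consts_le _ _ _ (plan_consts tc (plan tc bs)) (moments_fix 8 b (block_fix b))) => //.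
  by apply: good_primes => c c_bs; apply: ok_bs; rewrite inE c_bs orbT.
apply: moments_fix_le => // [[w [g g']]] /(allP b_keys) /andP[/= g_gt0 g'_gt0].
by rewrite expr1; apply: block_fix_ge; rewrite ?prime_gt1.
Qed.

(** Only the event with the smaller threshold gets Chernoff's bound; the other one gets the trivial
    bound 1. *)
Lemma leaves_bound bs T U : {in bs, forall b, good_block b} ->
  forall cs, moments_le bs 1 cs ->
  let g := if (T <? U)%num then leaf T cs fix_one else leaf U cs fix_one in
  let r := if (T <? U)%num then (g, fix_one) else (fix_one, g) in
  prob_bound bs T r.1 /\ prob_bound (map flip bs) U r.2.
Proof.
move=> ok_bs cs le_cs.
have le1 : prob_bound bs T fix_one.
  by move=> t _; rewrite fixr_one (@prob_le1 1 0) // => b /ok_bs[].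
have le1' : prob_bound (map flip bs) U fix_one.
  move=> t _; rewrite fixr_one (@prob_le1 0 1) // => _ /mapP[b /ok_bs[b_ok _ _] ->].
  exact: flip_ok.
have flip_pr : all prime (map bprime (map flip bs)).
  by rewrite -map_comp; exact: (good_primes ok_bs).
case: (T <? U)%num; split=> // t /andP[t_ge0 le_t].
  by apply: (@leaf_bound _ _ 1) => //; [exact: good_primes | apply: le1; rewrite t_ge0].
apply: (@leaf_bound _ _ 1) => //; last by apply: le1'; rewrite t_ge0.
exact: moments_le_flip.
Qed.

(** The search branches over [bs] only; the blocks of [tl], of arbitrary number, enter through the
    uniform constants [tc]. *)
Lemma search_bound tc bs tl T U tau : {in bs ++ tl, forall b, good_block b} ->
  moments_le tl 1 tc ->
  prob_bound (bs ++ tl) T (search tc (plan tc bs) T U tau).1 /\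
  prob_bound (map flip (bs ++ tl)) U (search tc (plan tc bs) T U tau).2.
Proof.
move=> ok_bs le_tl; elim: bs ok_bs T U tau => [|b bs IHbs] ok_bs T U tau.
  exact: (leaves_bound T U ok_bs le_tl).
have le_b := plan_consts_le ok_bs le_tl.
rewrite [search _ _ _ _ _]/= -/(plan_consts tc (plan tc (b :: bs))) -/(plan tc _).
have := leaves_bound T U ok_bs le_b => /=; set g := (X in (X, _)).
set triv := (X in prob_bound _ _ X.1) => triv_ok.
case: (g <=? tau)%num => //.
have [[b_pr _ _] b_keys _] := ok_bs b (mem_head _ _).
apply: (@node_bound _ b (bs ++ tl)) => // T' U' tau'; apply: IHbs => c c_bs.
by apply: ok_bs; rewrite inE c_bs orbT.
Qed.

(** * Moments over the primes from 200 on *)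

Definition tail_blocks (r : nat) : seq block :=
  [seq prime_block p | p <- iota 200 r & prime p].

Lemma tail_weight200 : tail_weight 200 = (qN 160000)^-1.
Proof.
have -> : qN 160000 = qN (N.of_nat 16) * (qN (N.of_nat 100) * qN (N.of_nat 100)).
  by rewrite -!qNM.
by rewrite !qN_of_nat /tail_weight expr2.
Qed.

(** Fixed-point form of [excess_double], with p^2 >= 40000 in the quadratic term; truncated
    subtraction can only increase the bound. *)
Lemma excess_fix k A p : (200 <= p)%N -> 0 <= fixr A -> excess k p <= fixr A / p%:R ^+ 2 ->
  excess k.*2 p <= fixr (4 * A - 2 * N.of_nat k * fix_one
    + fix_div (A * A) (fix_one * 40000)) / p%:R ^+ 2.
Proof.
move=> p_ge A_ge0 le_e; have p_gt1 : (1 < p)%N by apply: leq_trans p_ge.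
have p2_ge : qN 40000 <= p%:R ^+ 2.
  have -> : qN 40000 = qN (N.of_nat 200) * qN (N.of_nat 200) by rewrite -qNM.
  by rewrite expr2 qN_of_nat; apply: ler_pM; rewrite ?ler0n ?ler_nat.
have p2_gt0 : 0 < p%:R ^+ 2 :> rat by apply: lt_le_trans p2_ge; apply: qN_gt0.
apply: le_trans (excess_double p_gt1 le_e) _; rewrite ler_pM2r ?invr_gt0 //.
rewrite fixrD lerD //.
  apply: le_trans (fixr_sub_le _ _); rewrite !fixrM fixr_one mulr1 qNM qN_of_nat.
  by rewrite !qNE.
apply: le_trans (fixr_div_le _ _); rewrite fixrM qNM.
have -> : qN A * fixr A / (qN fix_one * qN 40000) = fixr A ^+ 2 / qN 40000.
  by rewrite invfM mulrA [qN A * _ / _]mulrAC expr2.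
by rewrite ler_wpM2l ?sqr_ge0 // lef_pV2 ?posrE // qN_gt0.
Qed.

(** Each moment is at most 1 + A'/p^3, so [prod_tail_le] bounds the product by 1 / (1 - A'/160000),
    whatever r is. *)
Lemma tail_consts_le J k A r : (forall p, (200 <= p)%N -> excess k p <= fixr A / p%:R ^+ 2) ->
  moments_le (tail_blocks r) k (tail_consts J (N.of_nat k) A).
Proof.
elim: J k A => // J IHJ k A le_e; rewrite /tail_consts -/tail_consts.
set A' := (_ + _)%num.
have le_e' p : (200 <= p)%N -> excess k.*2 p <= fixr A' / p%:R ^+ 2.
  by move=> p_ge; apply: excess_fix => //; [exact: fixr_ge0 | exact: le_e].
case ltA : (_ <? _)%num; last by [].
split; last by rewrite (_ : 2 * N.of_nat k = N.of_nat k.*2)%num; [exact: IHJ | lia].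
have lt_A : (A' < 160000 * fix_one)%num by apply/N.ltb_lt.
have fixM : fixr (160000 * fix_one) = qN 160000 by rewrite fixrM fixr_one mulr1.
have qM_gt0 : 0 < qN 160000 by apply: qN_gt0.
have A_lt : fixr A' < qN 160000.
  by rewrite -fixM /fixr ltr_pM2r ?invr_gt0 ?fix_one_gt0 // !qNE ltr_nat; lia.
have Aw_lt1 : fixr A' * tail_weight 200 < 1.
  by rewrite tail_weight200 ltr_pdivrMr ?mul1r.
apply: le_trans (fixr_div_le _ _); rewrite fixr_oneM.
have -> : qN (160000 * fix_one) / qN (160000 * fix_one - A') = (1 - fixr A' * tail_weight 200)^-1.
  have qM0 : qN (160000 * fix_one) != 0.
    by rewrite qNM gt_eqF // mulr_gt0 // fix_one_gt0.
  have -> : fixr A' * tail_weight 200 = qN A' / qN (160000 * fix_one).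
    by rewrite tail_weight200 qNM invfM mulrCA mulrC.
  rewrite qN_sub; last exact: N.lt_le_incl.
  by rewrite -[1 in RHS](mulfV qM0) -mulrBl invfM invrK mulrC.
rewrite -[leRHS]mul1r ler_pdivlMr ?subr_gt0 //.
apply: le_trans (prod_tail_le r tail_weight_succ tail_weight_odd (fixr_ge0 A') _ (ltW Aw_lt1));
  last by [].
rewrite ler_wpM2r ?subr_ge0 ?(ltW Aw_lt1) // big_map !big_seq.
apply: ler_prod => p; rewrite mem_filter mem_iota => /andP[p_pr /andP[p_ge _]].
rewrite moment_ge0 //= moment_prime_block ?prime_gt1 // lerD2l exprSr invfM mulrA.
by rewrite ler_wpM2r ?invr_ge0 ?ler0n // le_e'.
Qed.

(** * The density *)

Lemma prime_block_good p : prime p -> odd p -> good_block (prime_block p).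
Proof.
move=> p_pr p_odd; split; first exact: prime_block_ok.
  by rewrite /keys_gt0 /= prime_gt0.
by rewrite /= perm_cons; apply: (permEl (perm_catC [:: _] [:: _])).
Qed.

Lemma block2_ok : block_ok 1 0 block2.
Proof. by split=> //; exists 6. Qed.

Lemma block3_good : good_block block3.
Proof. by split=> //; split=> //; exists 3. Qed.

Lemma block5_good : good_block block5.
Proof. by split=> //; split=> //; exists 2. Qed.

Definition all_blocks r := block2 :: (odd_blocks ++ tail_blocks r).

Lemma all_blocks_good r : {in odd_blocks ++ tail_blocks r, forall b, good_block b}.
Proof.
have iota_good m k : (2 < m)%N ->
    {in [seq prime_block p | p <- iota m k & prime p], forall b, good_block b}.
  move=> m_gt2 b /mapP[p]; rewrite mem_filter mem_iota => /andP[p_pr /andP[le_mp _]] ->.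
  apply: prime_block_good => //; case/even_prime: p_pr => // p2.
  by rewrite p2 leqNgt m_gt2 in le_mp.
move=> b; rewrite mem_cat => /orP[|]; last exact: iota_good.
rewrite in_cons => /predU1P[-> | ]; first exact: block3_good.
rewrite in_cons => /predU1P[-> | ]; first exact: block5_good.
exact: iota_good.
Qed.

Lemma all_blocks_primes r : map bprime (all_blocks r)
  = [:: 2, 3, 5 & [seq p <- iota 7 (193 + r) | prime p]]%N.
Proof.
have bprime_map s : map bprime [seq prime_block p | p <- s] = s by rewrite -map_comp map_id.
rewrite (iotaD 7 193 r) filter_cat /all_blocks /odd_blocks /tail_blocks.
rewrite (_ : 7 + 193 = 200)%N //.
move: (iota 7 193) (iota 200 r) => s1 s2.
by rewrite !(cat_cons, map_cons) map_cat !bprime_map.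
Qed.

Lemma all_blocks_uniq r : uniq (map bprime (all_blocks r)).
Proof.
rewrite all_blocks_primes.
have uniq_s : uniq [seq p <- iota 7 (193 + r) | prime p] by rewrite filter_uniq // iota_uniq.
have small_s p : (p < 7)%N -> p \notin [seq p <- iota 7 (193 + r) | prime p].
  by rewrite ltnNge mem_filter mem_iota => /negbTE->; rewrite andbF.
move: [seq p <- _ | _] uniq_s small_s => s uniq_s small_s.
rewrite !cons_uniq !in_cons uniq_s.
by rewrite (negbTE (small_s 2 isT)) (negbTE (small_s 3 isT)) (negbTE (small_s 5 isT)).
Qed.

Lemma all_blocks_mem r p : prime p -> (p <= 199 + r)%N -> p \in map bprime (all_blocks r).
Proof.
move=> p_pr le_p; rewrite all_blocks_primes 3!in_cons mem_filter mem_iota p_pr.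
case: (ltnP p 7) => [ltp7 | le7p]; first by move: p_pr ltp7 {le_p}; do 7![case: p => [|p] //].
have -> : (p < 7 + (193 + r))%N by lia.
by rewrite !orbT.
Qed.

Lemma excess1_le p : (200 <= p)%N ->
  excess 1 p <= fixr (fix_div (80000 * fix_one) 39999) / p%:R ^+ 2.
Proof.
move=> p_ge; have p_gt1 : 1 < p%:R :> rat by rewrite ltr1n (leq_trans _ p_ge).
have p2_ge : qN 40000 <= p%:R ^+ 2.
  have -> : qN 40000 = qN (N.of_nat 200) * qN (N.of_nat 200) by rewrite -qNM.
  by rewrite expr2 qN_of_nat; apply: ler_pM; rewrite ?ler0n ?ler_nat.
have qN_eq : qN 40000 = qN 39999 + 1 by rewrite -[1]/(1%:R) -(qN_of_nat 1) -qND.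
have qN_eq2 : qN 80000 = 2 * qN 40000.
  by rewrite -[2]/(2%:R) -(qN_of_nat 2) -qNM.
have q_gt0 : 0 < qN 39999 by apply: qN_gt0.
have p2_gt0 : 0 < p%:R ^+ 2 :> rat by rewrite exprn_gt0 // (lt_trans _ p_gt1).
apply: le_trans (_ : qN 80000 / qN 39999 / p%:R ^+ 2 <= _); last first.
  rewrite ler_wpM2r ?invr_ge0 ?(ltW p2_gt0) //; apply: le_trans (fixr_div_le _ _).
  by rewrite fixrM fixr_one mulr1.
rewrite /excess !expr1 qN_eq2 qN_eq.
rewrite qN_eq in p2_ge; move: (qN 39999) p%:R q_gt0 p2_ge p_gt1 p2_gt0 => m x.
move=> m_gt0 x_ge x_gt1 x2_gt0.
have [x1 x1'] : x - 1 != 0 /\ x + 1 != 0 by rewrite !gt_eqF //; lra.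
have x2_gt1 : 0 < x ^+ 2 - 1 by nra.
have -> : x / (x - 1) + x / (x + 1) - 2 = 2 / (x ^+ 2 - 1).
  by field; rewrite x1 x1' gt_eqF.
rewrite ler_pdivlMr // mulrAC ler_pdivrMr // mulrAC ler_pdivlMr //.
nra.
Qed.

Lemma prob_all_blocks r t : 0 <= t <= fixr start ->
  prob (all_blocks r) t <= fixr 345209 /\ prob (map flip (all_blocks r)) t <= fixr 16596517.
Proof.
move=> le_t; have good_r := @all_blocks_good r.
have le_tl : moments_le (tail_blocks r) 1 tail0.
  exact: (@tail_consts_le 8 1 _ r excess1_le).
have := @node_bound (search tail0 (plan tail0 odd_blocks)) block2
  (odd_blocks ++ tail_blocks r) start start 251.
rewrite search_result => /(_ isT isT) [|up dn].
  by move=> T U tau; apply: search_bound.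
by split; [apply: up | apply: dn].
Qed.

Lemma qN_div_le_cross a b c d : (0 < b)%num -> (0 < d)%num -> (a * d <= c * b)%num ->
  qN a / qN b <= qN c / qN d.
Proof.
move=> b_gt0 d_gt0 le_ab; rewrite ler_pdivrMr ?qN_gt0 // mulrAC ler_pdivlMr ?qN_gt0 //.
by rewrite -!qNM qN_le.
Qed.

(** For a fixed positive slack the rough set has density O(1/Q); the value 7 keeps (1 + slack)^2
    below [start]. *)
Definition slack : rat := fixr 7.

Definition nearly_le (s s' : nat) : pred nat :=
  fun n => abund (4 * n + s') <= abund (4 * n + s) * (1 + slack).

(** The 20 units added to c absorb the rough set, and M, the period, absorbs the incomplete last
    period. *)
Lemma count_le s s' (bs : nat -> seq block) c d m : (s <= 1)%N ->
  (forall r, {in bs r, forall b, block_ok s s' b}) ->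
  (forall r, map bprime (bs r) = map bprime (all_blocks r)) ->
  (forall r, prob (bs r) ((1 + slack) ^+ 2) <= fixr c) ->
  (0 < m)%num -> ((c + 20) * m <= d * fix_one)%num ->
  exists M : nat, forall x : nat,
    (N.of_nat (count (nearly_le s s') (iota 1 x)) * m
     <= d * N.of_nat (x + M))%num.
Proof.
move=> s_le1 ok_bs eq_bs le_bs m_gt0 le_cd.
have slack_gt0 : 0 < slack by rewrite divr_gt0 ?fix_one_gt0 // qN_gt0.
have tw_gt0 : 0 < fixr 20 by rewrite divr_gt0 ?fix_one_gt0 // qN_gt0.
(* With Q >= r this brings the rough term (4x + s) / (Q * slack) below 20 units times x + M. *)
have [r r_big] : exists r : nat, 4%:R / slack / fixr 20 <= r%:R.
  exists (Num.bound (4%:R / slack / fixr 20)).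
  apply/ltW/archi_boundP; apply: (divr_ge0 _ (ltW tw_gt0)).
  exact: (divr_ge0 (ler0n _ _) (ltW slack_gt0)).
have M_gt0 : (0 < period (bs r))%N by apply: period_gt0 (ok_bs r).
exists (period (bs r)) => x; set cnt := count _ _; set M := period _ in M_gt0 *.
have [Q [Q_gt0 le_rQ bs_Q]] : exists Q, [/\ (0 < Q)%N, (r <= Q)%N &
    forall p, prime p -> (p <= Q)%N -> p \in map bprime (all_blocks r)].
  by exists (199 + r)%N; split=> [||p]; [| exact: leq_addl | exact: all_blocks_mem].
have := @count_abund_le s s' (bs r) Q x slack (ok_bs r).
rewrite eq_bs all_blocks_uniq -/cnt -/M => /(_ isT bs_Q Q_gt0 slack_gt0) le_cnt.
have rough_le : (4 * x + s)%:R / Q%:R / slack <= (x + M)%:R * fixr 20.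
  rewrite mulrAC ler_pdivrMr ?ltr0n // ler_pdivrMr //.
  apply: (@le_trans _ _ ((x + M)%:R * 4%:R)).
    by rewrite -natrM ler_nat; lia.
  have -> : (x + M)%:R * fixr 20 * Q%:R * slack
      = (x + M)%:R * (Q%:R * (fixr 20 * slack)) by ring.
  rewrite ler_wpM2l ?ler0n //; move: r_big; rewrite ler_pdivrMr // ler_pdivrMr // => r_big.
  apply: le_trans r_big _; rewrite -[leLHS]mulrA; apply: ler_wpM2r.
    by apply: mulr_ge0; apply: ltW.
  by rewrite ler_nat.
have {le_cnt} : cnt%:R <= (x + M)%:R * fixr (c + 20).
  apply: le_trans le_cnt _; rewrite fixrD mulrDr lerD // ler_wpM2l ?ler0n //.
rewrite -(qN_of_nat cnt) -(qN_of_nat (x + M)) => le_cnt.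
suff : qN (N.of_nat cnt * m) <= qN (d * N.of_nat (x + M)) by rewrite !qNE ler_nat; lia.
rewrite !qNM mulrC -ler_pdivlMl ?qN_gt0 //; apply: le_trans le_cnt _.
rewrite [leRHS]mulrA [leRHS]mulrC; apply: ler_wpM2l; first exact: qN_ge0.
by rewrite [leRHS]mulrC; apply: qN_div_le_cross.
Qed.

Lemma slack_sqr_le : 0 <= (1 + slack) ^+ 2 <= fixr start.
Proof.
have one_gt0 := fix_one_gt0.
(* 16 = 2 * 7 + 2, where the last 2 leaves room for the square of the slack. *)
have -> : fixr start = 1 + 2 * slack + fixr 2.
  by rewrite /start fixrD fixr_one -addrA /slack; congr (_ + _);
     rewrite -[2]/(2%:R) -(qN_of_nat 2) -fixrM -fixrD.
have slack_ge0 : 0 <= slack by apply: fixr_ge0.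
have slack_le : slack * slack <= fixr 2.
  rewrite {1}/slack; apply: le_trans (fixr_mul_le _ _) _; exact: fixr_le.
by apply/andP; split; [exact: sqr_ge0 | rewrite expr2; lra].
Qed.

Lemma sum_divisors_abund n : (0 < n)%N -> (sum_divisors n)%:R = abund n * n%:R.
Proof. by move=> n_gt0; rewrite /abund divfK // pnatr_eq0 -lt0n. Qed.

(** Passing from sigma to abundancies costs the factor 1 + 1/(4n), which is at most 1 + slack as
    soon as n >= 1/slack. *)
Lemma setA_nearly_le : exists n0, forall n, (n0 <= n)%N -> setA 4 1 0 n -> nearly_le 1 0 n.
Proof.
have slack_gt0 : 0 < slack by rewrite divr_gt0 ?fix_one_gt0 // qN_gt0.
exists (Num.bound slack^-1) => n le_n /andP[n_gt0 lt_sig]; rewrite /nearly_le.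
have n_big : slack^-1 <= n%:R.
  apply/ltW; apply: lt_le_trans (archi_boundP _) _; last by rewrite ler_nat.
  by rewrite invr_ge0 ltW.
have n0 : 0 < n%:R :> rat by rewrite ltr0n.
have a_gt0 : 0 < abund (4 * n + 1) by rewrite abund_gt0 // addn1.
move: lt_sig; rewrite addn0 -(ltr_nat rat) !sum_divisors_abund ?addn_gt0 ?muln_gt0 ?n_gt0 //.
rewrite natrD !natrM.
move: (abund (4 * n + 1)) (abund (4 * n)) a_gt0 => a b a_gt0 lt_ab.
have : 1 <= n%:R * slack by rewrite -ler_pdivrMr // mul1r.
move: (n%:R) n0 lt_ab {n_big} => x x_gt0 lt_ab le_xs.
rewrite -(@ler_pM2r _ (4 * x)) ?mulr_gt0 //.
apply: le_trans (ltW lt_ab) _.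
have pos : 0 <= 4 * (x * slack) - 1 by lra.
by have := mulr_ge0 (ltW a_gt0) pos; lra.
Qed.

(** In this direction the passage costs 4n / (4n + 1) < 1, so every positive n qualifies. *)
Lemma setAC_nearly_le n : (0 < n)%N -> ~~ setA 4 1 0 n -> nearly_le 0 1 n.
Proof.
move=> n_gt0; rewrite /setA /= n_gt0 /= -leqNgt -(ler_nat rat) /nearly_le.
rewrite addn0 !sum_divisors_abund ?addn_gt0 ?muln_gt0 ?n_gt0 //.
have a_gt0 : 0 < abund (4 * n + 1) by rewrite abund_gt0 // addn1.
have b_gt0 : 0 < abund (4 * n) by rewrite abund_gt0 ?muln_gt0.
have slack_ge0 : 0 <= slack by apply: fixr_ge0.
have x_gt0 : 0 < (4 * n)%:R :> rat by rewrite ltr0n muln_gt0.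
rewrite natrD; move: (4 * n)%:R x_gt0 => x x_gt0.
move: (abund (4 * n + 1)) (abund (4 * n)) a_gt0 b_gt0 => a b a_gt0 b_gt0 le_ab.
apply: (@le_trans _ _ b); last by rewrite ler_peMr ?lerDl // ltW.
by rewrite -(@ler_pM2r _ x) //; lra.
Qed.

Lemma counting_le : exists M : nat, forall x : nat,
  (N.of_nat (counting (setA 4 1 0) x) * 10000000 <= 207187 * N.of_nat (x + M))%num.
Proof.
have [M le_M] : exists M, forall x : nat,
    (N.of_nat (count (nearly_le 1 0) (iota 1 x)) * 10000000 <= 207187 * N.of_nat (x + M))%num.
  apply: (@count_le 1 0 all_blocks 345209) => // r.
    move=> b; rewrite in_cons => /predU1P[-> | /all_blocks_good[]//].
    exact: block2_ok.
  exact: (prob_all_blocks r slack_sqr_le).1.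
have [n0 near_n0] := setA_nearly_le.
(* At most n0 values of n are exceptional, and 10000000 * n0 <= 207187 * (100 * n0). *)
exists (M + 100 * n0)%N => x.
have : (counting (setA 4 1 0) x <= count (nearly_le 1 0) (iota 1 x) + n0)%N.
  apply: (@leq_trans (count (predU (nearly_le 1 0) (fun n => n < n0)%N) (iota 1 x))).
    apply: sub_count => n An /=; case: (ltnP n n0) => [_ | le_n]; first by rewrite orbT.
    by rewrite near_n0.
  have le_n0 : (count (fun n => n < n0)%N (iota 1 x) <= n0)%N.
    rewrite -size_filter -[X in (_ <= X)%N](size_iota 0 n0); apply: uniq_leq_size.
      by rewrite filter_uniq ?iota_uniq.
    by move=> n; rewrite mem_filter !mem_iota => /andP[].
  by have := count_predUI (nearly_le 1 0) (fun n => n < n0)%N (iota 1 x); lia.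
by move: (le_M x); lia.
Qed.

(** The lower bound is an upper bound on the complement: 9892447 = 10000000 - 107553. *)
Lemma counting_ge : exists M : nat, forall x : nat,
  (N.of_nat (x - counting (setA 4 1 0) x) * 10000000 <= 9892447 * N.of_nat (x + M))%num.
Proof.
have [M le_M] : exists M, forall x : nat,
    (N.of_nat (count (nearly_le 0 1) (iota 1 x)) * 10000000 <= 9892447 * N.of_nat (x + M))%num.
  apply: (@count_le 0 1 (fun r => map flip (all_blocks r)) 16596517) => // r.
  - move=> _ /mapP[b b_r ->]; apply: flip_ok; move: b_r.
    by rewrite in_cons => /predU1P[-> | /all_blocks_good[]//]; apply: block2_ok.
  - by rewrite -map_comp.
  - exact: (prob_all_blocks r slack_sqr_le).2.
exists M => x; have : (x - counting (setA 4 1 0) x <= count (nearly_le 0 1) (iota 1 x))%N.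
  rewrite leq_subLR -{1}(size_iota 1 x) -(count_predC (setA 4 1 0)) leq_add2l.
  rewrite -!size_filter; apply: uniq_leq_size; first by rewrite filter_uniq ?iota_uniq.
  move=> n; rewrite !mem_filter mem_iota => /andP[notA n_x]; rewrite n_x andbT.
  by apply: setAC_nearly_le => //; case/andP: n_x.
by move: (le_M x); lia.
Qed.

Local Open Scope R_scope.

Lemma is_lim_seq_affine_inv (c d : R) : is_lim_seq (fun x => c + d * / INR x) c.
Proof.
have lim_inv : is_lim_seq (fun x => / INR x) 0.
  by apply: (is_lim_seq_inv INR p_infty) => //; apply: is_lim_seq_INR.
have := is_lim_seq_plus' _ _ _ _ (is_lim_seq_const c) (is_lim_seq_scal_l _ d _ lim_inv).
by rewrite Rmult_0_r Rplus_0_r.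
Qed.

Theorem theorem1p3 :
  Rbar_le (Rbar.Finite (107553 / 10000000)) (natural_density (setA 4 1 0)) /\
  Rbar_le (natural_density (setA 4 1 0)) (Rbar.Finite (207187 / 10000000)).
Proof.
have [M up] := counting_le; have [M' low] := counting_ge.
have x_gt0 x : (1 <= x)%coq_nat -> 0 < INR x by move=> ?; apply: lt_0_INR; lia.
split.
  (* [Lim_seq] respects eventual inequalities, so it suffices to compare with a sequence whose limit
     is the bound: for x >= 1 the quotient is at least 0.0107553 - 0.9892447 * M' / x. *)
  rewrite -(is_lim_seq_unique _ _
    (@is_lim_seq_affine_inv (107553 / 10000000) (- (9892447 / 10000000) * INR M'))).
  apply: Lim_seq_le_loc; exists 1%N => x /x_gt0 x0.
  have cnt_le : (counting (setA 4 1 0) x <= x)%N.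
    by rewrite /counting -[X in (_ <= X)%N](size_iota 1 x) count_size.
  have : Z.le (Z.mul 10000000 (Z.sub (Z.of_nat x) (Z.of_nat (counting (setA 4 1 0) x))))
      (Z.mul 9892447 (Z.add (Z.of_nat x) (Z.of_nat M'))) by move: (low x); lia.
  move/IZR_le; rewrite !mult_IZR minus_IZR plus_IZR -!INR_IZR_INZ => le_x.
  apply: (Rmult_le_reg_r (INR x)) => //; rewrite /Rdiv Rmult_plus_distr_r.
  by rewrite !(Rmult_assoc _ (/ INR x)) Rinv_l; Lra.lra.
rewrite -(is_lim_seq_unique _ _
  (@is_lim_seq_affine_inv (207187 / 10000000) (207187 / 10000000 * INR M))).
apply: Lim_seq_le_loc; exists 1%N => x /x_gt0 x0.
have : Z.le (Z.mul 10000000 (Z.of_nat (counting (setA 4 1 0) x)))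
    (Z.mul 207187 (Z.add (Z.of_nat x) (Z.of_nat M))) by move: (up x); lia.
move/IZR_le; rewrite !mult_IZR plus_IZR -!INR_IZR_INZ => le_x.
apply: (Rmult_le_reg_r (INR x)) => //; rewrite /Rdiv Rmult_plus_distr_r.
by rewrite !(Rmult_assoc _ (/ INR x)) Rinv_l; Lra.lra.
Qed.
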